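(* Let $G$ be a simply connected five dimensional nilpotent Lie group with a left invariant Riemannian metric $\tilde a$, whose Lie algebra $\mathfrak l_{5,7}$ has an $\tilde a$-orthonormal basis $\{E_1,\dots,E_5\}$ with non-zero brackets $[E_1,E_2]=aE_3+bE_4+cE_5$, $[E_1,E_3]=dE_4+fE_5$, $[E_1,E_4]=gE_5$, where $a,d,g>0$ and either $b>0$, or $b=0$ and $f\ge0$. If $F$ is any left invariant non-Riemannian $(\alpha,\beta)$-metric of Douglas type on $G$ defined by $\tilde a$ and a left invariant vector field $X$, then $F$ must be a Randers metric.
   Context: Brackets of basis elements not listed (and not obtained by antisymmetry) are zero. An $(\alpha,\beta)$-metric is a Finsler metric $F=\alpha\,\phi(\beta/\alpha)$, where $\alpha(x,y)=\sqrt{\tilde a(y,y)}$ is the norm of a Riemannian metric $\tilde a$, $\beta$ is a 1-form, and $\phi:(-b_0,b_0)\to\mathbb R^+$ is a $C^\infty$ function with $\phi(s)-s\phi'(s)+(b^2-s^2)\phi''(s)>0$ for $|s|\le b<b_0$, and $\|\beta_x\|_\alpha<b_0$ for all $x$. It is defined by $\tilde a$ and a vector field $X$ if $\beta(x,y)=\tilde a(y,X(x))$; here $\tilde a$ and $X$ are left invariant. A Randers metric is a Finsler metric of the form $\alpha+\beta$ (the case $\phi(s)=1+s$, $b_0=1$), with $\alpha$ the norm of a Riemannian metric and $\beta$ a 1-form of $\alpha$-norm less than one. The spray coefficients of $F$ in standard local coordinates $(x,y)$ of the tangent bundle are $G^i=\frac14 g^{il}\big([F^2]_{x^my^l}y^m-[F^2]_{x^l}\big)$,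 where $g_{ij}=\frac12\frac{\partial^2F^2}{\partial y^i\partial y^j}$. $F$ is of Douglas type if in every standard local coordinate system $G^i=\frac12\Gamma^i_{jk}(x)y^jy^k+P(x,y)y^i$ for some functions $\Gamma^i_{jk}(x)$ and some local function $P(x,y)$ positively homogeneous of degree one in $y$. *)

(* Defs.v *)
From HB Require Import structures.
From mathcomp Require Import all_boot all_order all_algebra.
From mathcomp Require Import all_classical all_reals all_analysis.

Set Implicit Arguments.
Unset Strict Implicit.
Unset Printing Implicit Defensive.

Import Order.TTheory GRing.Theory Num.Theory.
Import numFieldNormedType.Exports.

Local Open Scope classical_set_scope.
Local Open Scope ring_scope.

(* For finite-dimensional V this is the usual notion of C^k map on an open
   set U: the iterated directional derivatives of order <= k exist and are
   continuous on U. *)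
Fixpoint Ck (R : realType) (V W : normedModType R) (k : nat) (U : set V)
    (f : V -> W) : Prop :=
  (forall x, U x -> {for x, continuous f}) /\
  if k is k'.+1 then
    forall v, (forall x, U x -> derivable f x v) /\
              Ck k' U (fun x => 'D_v f x)
  else True.

Definition smooth_on (R : realType) (V W : normedModType R) (U : set V)
  (f : V -> W) : Prop := forall k, Ck k U f.

Section Manifolds.
Context {R : realType} {n : nat}.
Local Notation E := 'rV[R]_n.+1.

(* The inverse is a total function; its values outside the image of the
   domain are irrelevant. *)
Record chart (M : topologicalType) := Chart {
  chart_dom : set M;
  chart_map :> M -> E;
  chart_inv : E -> M;
  chart_dom_open : open chart_dom;
  chart_img_open : open (chart_map @` chart_dom);
  chart_mapK : forall p, chart_dom p -> chart_inv (chart_map p) = p;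
  chart_map_cont : forall p, chart_dom p -> {for p, continuous chart_map};
  chart_inv_cont : forall x, (chart_map @` chart_dom) x ->
    {for x, continuous chart_inv} }.

Definition chart_img (M : topologicalType) (c : chart M) : set E :=
  c @` chart_dom c.

Definition smooth_transition (M : topologicalType) (c c' : chart M) : Prop :=
  smooth_on (c @` (chart_dom c `&` chart_dom c')) (c' \o chart_inv c).

(* An (n+1)-dimensional smooth manifold structure on M: a maximal atlas. A
   chart around each point is chosen once and for all, and a tangent vector at
   p is represented by its components in the chart chosen at p. *)
Record smooth_structure (M : topologicalType) := SmoothStructure {
  atlas : set (chart M);
  chart_at : M -> chart M;
  manifold_hausdorff : hausdorff_space M;
  manifold_second_countable : @second_countable M;
  chart_at_atlas : forall p, atlas (chart_at p);
  chart_at_dom : forall p, chart_dom (chart_at p) p;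
  atlas_compatible : forall c c', atlas c -> atlas c' ->
    smooth_transition c c';
  atlas_maximal : forall c,
    (forall c', atlas c' -> smooth_transition c c' /\ smooth_transition c' c) ->
    atlas c }.

Context {M : topologicalType} (S : smooth_structure M).

Definition tangent (p : M) : Type := E.

(* The tangent vector at the point with coordinates x in the chart c whose
   components in c are y. *)
Definition tangent_of_coord (c : chart M) (x y : E) : tangent (chart_inv c x) :=
  'D_y (chart_at S (chart_inv c x) \o chart_inv c) x.

Definition coord_of_tangent (c : chart M) (p : M) (v : tangent p) : E :=
  'D_v (c \o chart_inv (chart_at S p)) (chart_at S p p).

Definition tangent_map (f : M -> M) (p : M) (v : tangent p) : tangent (f p) :=
  'D_v (chart_at S (f p) \o f \o chart_inv (chart_at S p)) (chart_at S p p).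

Definition vector_field := forall p : M, tangent p.

Definition vf_coord (c : chart M) (X : vector_field) (x : E) : E :=
  coord_of_tangent c (X (chart_inv c x)).

(* [X, Y]^k = X^m d_m Y^k - Y^m d_m X^k, computed at p in the chart chosen
   at p. *)
Definition vf_bracket (X Y : vector_field) : vector_field := fun p =>
  let c := chart_at S p in
  'D_(vf_coord c X (c p)) (vf_coord c Y) (c p)
  - 'D_(vf_coord c Y (c p)) (vf_coord c X) (c p).

Definition basis_vec (i : 'I_n.+1) : E := delta_mx 0 i.

Definition one_form (beta : forall p, tangent p -> R) : Prop :=
  (forall p, scalar (beta p : E -> R)) /\
  (forall c, atlas S c -> forall i : 'I_n.+1,
    smooth_on (chart_img c) (fun x : E =>
      beta (chart_inv c x) (tangent_of_coord c x (basis_vec i)) : R)).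

Definition riemannian_metric (a : forall p, tangent p -> tangent p -> R) : Prop :=
  [/\ forall p u v, a p u v = a p v u,
      forall p u, scalar (a p u : E -> R),
      forall p (v : E), v != 0 -> 0 < a p v v
    & forall c, atlas S c -> forall i j : 'I_n.+1,
        smooth_on (chart_img c) (fun x : E =>
          a (chart_inv c x) (tangent_of_coord c x (basis_vec i))
            (tangent_of_coord c x (basis_vec j)) : R)].

Definition metric_norm (a : forall p, tangent p -> tangent p -> R) (p : M)
  (v : tangent p) : R := Num.sqrt (a p v v).

Definition one_form_norm (a : forall p, tangent p -> tangent p -> R)
    (beta : forall p, tangent p -> R) (p : M) : R :=
  sup [set `|beta p v| | v in [set v : tangent p | metric_norm a v <= 1]].

(* F(x, y) in the standard local coordinates of the tangent bundle induced
   by c. *)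
Definition coord_expr (F : forall p, tangent p -> R) (c : chart M) (x y : E) : R :=
  F (chart_inv c x) (tangent_of_coord c x y).

Definition fundamental_tensor (F : forall p, tangent p -> R) (c : chart M)
    (x y : E) : 'M[R]_n.+1 :=
  \matrix_(i, j) (2^-1 *
    'D_(basis_vec i)
      (fun y' : E => 'D_(basis_vec j)
        (fun y'' : E => coord_expr F c x y'' ^+ 2 : R) y') y).

Definition spray_coef (F : forall p, tangent p -> R) (c : chart M) (x y : E)
    (i : 'I_n.+1) : R :=
  4^-1 * \sum_l invmx (fundamental_tensor F c x y) i l *
    ((\sum_m 'D_(basis_vec l)
        (fun y' : E => 'D_(basis_vec m)
          (fun x' : E => coord_expr F c x' y' ^+ 2 : R) x) y * y 0 m)
     - 'D_(basis_vec l) (fun x' : E => coord_expr F c x' y ^+ 2 : R) x).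

Definition finsler_metric (F : forall p, tangent p -> R) : Prop :=
  [/\ forall p v, 0 <= F p v,
      forall p (v : E) (k : R), 0 < k -> F p (k *: v) = k * F p v,
      forall c, atlas S c ->
        smooth_on [set z : E * E | chart_img c z.1 /\ z.2 != 0]
          (fun z => coord_expr F c z.1 z.2 : R)
    & forall c, atlas S c -> forall x y : E, chart_img c x -> y != 0 ->
        forall v : E, v != 0 ->
          0 < (v *m fundamental_tensor F c x y *m v^T) 0 0].

Definition is_riemannian (F : forall p, tangent p -> R) : Prop :=
  exists2 a, riemannian_metric a & forall p v, F p v = metric_norm (p := p) a v.

(* b0 = +oo is allowed. At v = 0 the formula F = alpha phi(beta / alpha) reads
   F = 0, by the convention 0 / 0 = 0. *)
Definition alpha_beta_metric (a : forall p, tangent p -> tangent p -> R)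
    (beta : forall p, tangent p -> R) (F : forall p, tangent p -> R) : Prop :=
  [/\ riemannian_metric a, one_form beta, finsler_metric F &
   exists (b0 : \bar R) (phi : R -> R),
   [/\ (forall s, (`|s|%:E < b0)%E -> 0 < phi s),
       smooth_on [set s : R | (`|s|%:E < b0)%E] phi,
       (forall s b : R, `|s| <= b -> (b%:E < b0)%E ->
          0 < phi s - s * derive1 phi s + (b ^+ 2 - s ^+ 2) * derive1n 2 phi s),
       (forall p, ((one_form_norm a beta p)%:E < b0)%E)
     & (forall p (v : tangent p),
          F p v = metric_norm a v * phi (beta p v / metric_norm a v))]].

Definition randers_metric (F : forall p, tangent p -> R) : Prop :=
  finsler_metric F /\
  exists (a : forall p, tangent p -> tangent p -> R)
         (beta : forall p, tangent p -> R),
  [/\ riemannian_metric a, one_form beta,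
      forall p, one_form_norm a beta p < 1
    & forall p (v : tangent p), F p v = metric_norm a v + beta p v].

Definition douglas_type (F : forall p, tangent p -> R) : Prop :=
  forall c, atlas S c ->
  exists (Gamma : 'I_n.+1 -> 'I_n.+1 -> 'I_n.+1 -> E -> R) (P : E -> E -> R),
    (forall x y (k : R), chart_img c x -> y != 0 -> 0 < k ->
       P x (k *: y) = k * P x y) /\
    (forall x y (i : 'I_n.+1), chart_img c x -> y != 0 ->
       spray_coef F c x y i =
         2^-1 * (\sum_j \sum_k Gamma i j k x * y 0 j * y 0 k) + P x y * y 0 i).

End Manifolds.

Arguments chart R n M : clear implicits.
Arguments smooth_structure R n M : clear implicits.
Arguments tangent R n {M} p.
Arguments vector_field R n M : clear implicits.

Section SimplyConnected.
Variables (R : realType) (T : topologicalType).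

Definition path_connected : Prop :=
  forall x y : T, exists gamma : R -> T,
    [/\ {within `[0, 1], continuous gamma}, gamma 0 = x & gamma 1 = y].

Definition null_homotopic (gamma : R -> T) : Prop :=
  exists H : R * R -> T,
    [/\ {within `[0, 1] `*` `[0, 1], continuous H},
        forall t, 0 <= t <= 1 -> H (0, t) = gamma t,
        forall t, 0 <= t <= 1 -> H (1, t) = gamma 0
      & forall s, 0 <= s <= 1 -> H (s, 0) = gamma 0 /\ H (s, 1) = gamma 0].

Definition simply_connected : Prop :=
  path_connected /\
  forall gamma : R -> T, {within `[0, 1], continuous gamma} ->
    gamma 0 = gamma 1 -> null_homotopic gamma.

End SimplyConnected.

Section Nilpotent.
Variable G : groupType.

Definition is_subgroup (H : set G) : Prop :=
  H 1%g /\ forall x y, H x -> H y -> H (x * y^-1)%g.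

Fixpoint lower_central (k : nat) : set G :=
  if k is k'.+1 then
    smallest is_subgroup
      [set z | exists x y, lower_central k' x /\ z = [~ x, y]%g]
  else setT.

Definition nilpotent_group : Prop := exists k, lower_central k = [set 1%g].

End Nilpotent.

(* No compatibility between the two structures is required here; it is part of
   lie_structure. *)
#[short(type="groupTopologicalType")]
HB.structure Definition GroupTopological := {G of Group G & Topological G}.

Record lie_structure (R : realType) (n : nat) (G : groupTopologicalType) :=
  LieStructure {
  lie_smooth_structure :> smooth_structure R n G;
  lie_mul_cont : continuous (fun z : G * G => (z.1 * z.2)%g);
  lie_inv_cont : continuous (fun p : G => p^-1%g);
  lie_mul_smooth : forall c1 c2 c3 : chart R n G,
    atlas lie_smooth_structure c1 -> atlas lie_smooth_structure c2 ->
    atlas lie_smooth_structure c3 ->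
    smooth_on
      [set z : 'rV[R]_n.+1 * 'rV[R]_n.+1 |
        [/\ chart_img c1 z.1, chart_img c2 z.2
          & chart_dom c3 (chart_inv c1 z.1 * chart_inv c2 z.2)%g]]
      (fun z => c3 (chart_inv c1 z.1 * chart_inv c2 z.2)%g);
  lie_inv_smooth : forall c1 c2 : chart R n G,
    atlas lie_smooth_structure c1 -> atlas lie_smooth_structure c2 ->
    smooth_on
      [set x : 'rV[R]_n.+1 | chart_img c1 x /\ chart_dom c2 (chart_inv c1 x)^-1%g]
      (fun x => c2 (chart_inv c1 x)^-1%g) }.

Section LeftInvariance.
Context {R : realType} {n : nat} {G : groupTopologicalType}.
Variable L : lie_structure R n G.

Definition left_translation (g p : G) : G := (g * p)%g.

Definition left_invariant_field (X : vector_field R n G) : Prop :=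
  forall g p, tangent_map L (left_translation g) (X p) = X (left_translation g p).

Definition left_invariant_metric
    (a : forall p : G, tangent R n p -> tangent R n p -> R) : Prop :=
  forall g p (u v : tangent R n p),
    a (left_translation g p) (tangent_map L (left_translation g) u)
      (tangent_map L (left_translation g) v) = a p u v.

Definition left_invariant_finsler (F : forall p : G, tangent R n p -> R) : Prop :=
  forall g p (v : tangent R n p),
    F (left_translation g p) (tangent_map L (left_translation g) v) = F p v.

(* The elements of the Lie algebra are the left invariant vector fields; in
   dimension n + 1 an orthonormal family of n + 1 of them is a basis. *)
Definition orthonormal_frame
    (a : forall p : G, tangent R n p -> tangent R n p -> R)
    (e : 'I_n.+1 -> vector_field R n G) : Prop :=
  (forall i, left_invariant_field (e i)) /\
  (forall i j p, a p (e i p) (e j p) = (i == j)%:R).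

End LeftInvariance.

(* The indices of e are shifted: E 1, ..., E 5 below are E_1, ..., E_5. *)
Definition l57_brackets (R : realType) (G : groupTopologicalType)
    (L : lie_structure R 4 G) (a b c d f g : R)
    (e : 'I_5 -> vector_field R 4 G) : Prop :=
  let E (k : nat) (p : G) : 'rV[R]_5 := e (inord k.-1) p in
  let B (i j : nat) (p : G) : 'rV[R]_5 := vf_bracket L (E i) (E j) p in
  forall p,
  [/\ B 1%N 2%N p = a *: E 3%N p + b *: E 4%N p + c *: E 5%N p,
      B 1%N 3%N p = d *: E 4%N p + f *: E 5%N p,
      B 1%N 4%N p = g *: E 5%N p,
      B 1%N 5%N p = 0
    & forall i j : nat, (1 < i < j)%N -> (j <= 5)%N -> B i j p = 0].

(* Main.v *)
From HB Require Import structures.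
Require Import Defs.
From mathcomp Require Import all_boot all_order all_algebra.
From mathcomp Require Import all_classical all_reals all_analysis.
From mathcomp Require Import ring lra.
Import Order.TTheory GRing.Theory Num.Theory.
Import numFieldNormedType.Exports.
Local Open Scope classical_set_scope.
Local Open Scope ring_scope.

(** In the orthonormal left invariant frame the vector field X has constant
    components x, and F is at every point the same Minkowski norm
    N(u) = |u| phi(s), s = <x,u> / |u|.  Douglas type says that, up to a
    multiple P(u) u, the spray is quadratic in u.  Read in the frame at the
    identity, where the structure equations turn the derivatives of the frame
    into brackets, it becomes: there is a quadratic map Q with
      d^2N_u (z, Q(u)) = dN_u ([z, u])    for all z and all u <> 0.
    The factor P disappears because N is homogeneous: pairing the spray
    equation with u itself determines P ([douglas_projective],
    [douglas_frame]).  From here on only linear algebra and one-variable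
    calculus are left.  Put kappa = phi - s phi', b = |x| and
    Delta = kappa + (b^2 - s^2) phi''; kappa and Delta are positive.

    Choosing z orthogonal to x and u removes phi'' from the equation:
      kappa(s) (<z, Q(u)> - <u, [z, u]>) = phi'(s) |u| <x, [z, u]>.
    Two cases arise according to the 2-form <x, [z, u]>, that is d beta.

    If it does not vanish, one vector z serves for all u on the two lines
    t x + r and t x - r, where <x, [z, u]> is affine in t and the factor of
    kappa is a polynomial in t.  Points with the same t on the two lines have
    the same s and the same |u|, so subtracting the equations shows that
    phi'(s) |u| / kappa(s) is a multiple of t; hence phi' = K s kappa
    ([nonclosed]).  This integrates to phi^2 = phi(0)^2 (1 + K s^2), and F is
    Riemannian, which is excluded ([riemannian_ode]).

    If it vanishes, the equation with z = x expresses phi'' / Delta, times the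
    quadratic form <u, [x, u]>, through polynomials in u.  Since that form
    vanishes on two orthonormal vectors v, w orthogonal to x but not on the
    plane they span, phi'' / Delta is forced to be constant
    ([closed_generic]).  The solutions are phi = eps s + C sqrt(m + k s^2)
    ([randers_ode]), and then F is the norm of C^2 (m a + k beta beta) plus
    eps beta.

    The Lie algebra enters only in [l57_douglas]: there suitable test vectors
    are exhibited for every nonzero x. *)

Set Implicit Arguments.
Unset Strict Implicit.
Unset Printing Implicit Defensive.

(** * C^k maps and Frechet differentiability *)

Section MeanValue.
Context {R : realType}.

Lemma is_derive_line (V W : normedModType R) (f : V -> W) (x v : V) (t : R) :
  derivable f (x + t *: v) v ->
  is_derive t 1 (fun s : R => f (x + s *: v)) ('D_v f (x + t *: v)).
Proof.
move=> df.
have E : (fun h : R => h^-1 *: (((fun s : R => f (x + s *: v)) \o shift t) h%:A -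
      f (x + t *: v))) =
    (fun h => h^-1 *: ((f \o shift (x + t *: v)) (h *: v) - f (x + t *: v))).
  apply: funext => h /=; congr (_ *: (f _ - _)).
  by rewrite [h%:A]mulr1 scalerDl addrCA addrA.
by split; rewrite /derivable /derive E.
Qed.

(** The mean value theorem along a segment, for either sign of the parameter:
    in coordinates the increments c have no sign. *)
Lemma MVT_line (V : normedModType R) (f : V -> R) (x v : V) (c : R) :
  (forall s, `|s| <= `|c| -> derivable f (x + s *: v) v) ->
  exists2 s, `|s| <= `|c| & f (x + c *: v) - f x = c * 'D_v f (x + s *: v).
Proof.
move=> df.
have H a b : a <= b -> (forall s, a <= s <= b -> `|s| <= `|c|) ->
   exists2 s, `|s| <= `|c| &
    f (x + b *: v) - f (x + a *: v) = (b - a) * 'D_v f (x + s *: v).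
  move=> ab abc; have [||s] := @MVT_segment R (fun s : R => f (x + s *: v))
      (fun s => 'D_v f (x + s *: v)) a b ab.
  - move=> s /[!in_itv]/= /andP[/ltW sa /ltW sb]; apply: is_derive_line.
    by apply/df/abc; rewrite sa.
  - apply: derivable_within_continuous => s /[!in_itv]/= sab.
    by apply: ex_derive; apply: is_derive_line; apply/df/abc.
  - rewrite in_itv/= => sab E; exists s; first exact: abc.
    by rewrite E mulrC.
have [c0|c0] := leP 0 c.
  have [|s sc] := H 0 c c0.
    by move=> s /andP[s0 sc]; rewrite !ger0_norm.
  by rewrite scale0r addr0 subr0; exists s.
have [|s sc] := H c 0 (ltW c0).
  by move=> s /andP[s0 sc]; rewrite ler0_norm// ler0_norm ?lerN2// ltW.
rewrite scale0r addr0 sub0r => E; exists s => //.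
by apply: oppr_inj; rewrite opprB E mulNr.
Qed.

(** Moving one direction at a time, each step is a mean value whose derivative is
    taken close to x, where continuity lets it be replaced by the one at x.  This
    is how continuous directional derivatives add up to a differential. *)
Lemma Ck1_increment (V : normedModType R) (U : set V) (f : V -> R) (x : V)
    (v : nat -> V) (k : nat) (e : R) : open U -> Ck 1 U f -> U x -> 0 < e ->
  exists2 d : R, 0 < d & forall c : nat -> R, (forall i, `|c i| < d) ->
    `|f (x + \sum_(i < k) c i *: v i) - f x - \sum_(i < k) c i * 'D_(v i) f x|
      <= e * \sum_(i < k) `|c i|.
Proof.
move=> oU [_ fC1] Ux e0; elim: k => [|k [d d0 IH]].
  by exists 1 => // c _; rewrite !big_ord0 addr0 !subrr normr0 mulr0.
have [df cdf] := fC1 (v k).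
have cf : {for x, continuous ('D_(v k) f)} by case: cdf => + _; apply.
have nU : \forall y \near x, U y /\ `|'D_(v k) f x - 'D_(v k) f y| <= e.
  apply: filterI; first exact: open_nbhs_nbhs.
  by move/cvgrPdist_le : cf; apply.
have /nbhs_ballP[r /= r0 rU] := nU.
pose M := 1 + \sum_(i < k.+1) `|v i|.
have M0 : 0 < M by rewrite ltr_pwDl// sumr_ge0.
exists (Num.min d (r / M)); first by rewrite lt_min d0 divr_gt0.
move=> c cd.
have cd1 i : `|c i| < d by have := cd i; rewrite lt_min => /andP[].
have cd2 i : `|c i| < r / M by have := cd i; rewrite lt_min => /andP[].
have near_x s : `|s| <= `|c k| -> ball x r (x + \sum_(i < k) c i *: v i + s *: v k).
  move=> sc; rewrite -ball_normE /= -addrA opprD addNKr normrN.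
  apply: (@le_lt_trans _ _ (\sum_(i < k.+1) (r / M) * `|v i|)).
    rewrite big_ord_recr/= (le_trans (ler_normD _ _))// lerD//; last first.
      by rewrite normrZ ler_wpM2r// (le_trans sc)// ltW.
    rewrite (le_trans (ler_norm_sum _ _ _))// ler_sum// => i _.
    by rewrite normrZ ler_wpM2r// ltW.
  rewrite -mulr_sumr -mulrA gtr_pMr// mulrC ltr_pdivrMr// mul1r.
  by rewrite /M ltrDr.
have [|s sc E] := @MVT_line V f (x + \sum_(i < k) c i *: v i) (v k) (c k).
  by move=> s sc; apply: df; apply: (rU _ (near_x _ sc)).1.
rewrite !big_ord_recr/= addrA.
rewrite -[f (_ + _ + _)](subrK (f (x + \sum_(i < k) c i *: v i))) E.
rewrite (_ : _ - _ = c k * ('D_(v k) f (x + \sum_(i < k) c i *: v i + s *: v k) - 'D_(v k) f x)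
  + (f (x + \sum_(i < k) c i *: v i) - f x - \sum_(i < k) c i * 'D_(v i) f x)); last by ring.
rewrite (le_trans (ler_normD _ _))// [leRHS]mulrDr [leLHS]addrC lerD//; first exact: IH.
rewrite normrM mulrC ler_wpM2r// distrC.
exact: (rU _ (near_x _ sc)).2.
Qed.
End MeanValue.

Section CkMaps.
Context {R : realType}.

Lemma Ck_le (V W : normedModType R) (U : set V) (f : V -> W) k :
  Ck k.+1 U f -> Ck k U f.
Proof.
elim: k f => [|k IH] f [cf df]; first by split.
by split=> // v; split; [exact: (df v).1|apply: IH; exact: (df v).2].
Qed.

Lemma near_open_eq (V W : normedModType R) (U : set V) (f g : V -> W) x :
  open U -> (forall y, U y -> f y = g y) -> U x -> \near x, f x = g x.
Proof.
move=> oU fg Ux; have : \forall y \near x, U y by exact: open_nbhs_nbhs.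
by apply: filterS => y /fg.
Qed.

(** Two maps that agree on an open set have the same derivatives there; this is
    what allows a chart expression to be replaced by a formula valid only on the
    image of the chart. *)
Lemma Ck_ext (V W : normedModType R) (U : set V) (f g : V -> W) k :
  open U -> (forall x, U x -> f x = g x) -> Ck k U f -> Ck k U g.
Proof.
move=> oU; elim: k f g => [|k IH] f g fg [cf df];
  have cg x : U x -> {for x, continuous g} by
    (move=> Ux; rewrite /prop_for /continuous_at -(fg _ Ux);
     apply: cvg_trans (cf _ Ux); apply: near_eq_cvg; exact: near_open_eq fg Ux).
  by [].
split=> // v; have [dv cv] := df v; split.
  by move=> x Ux; apply: near_eq_derivable (dv x Ux); exact: near_open_eq fg Ux.
apply: IH cv => x Ux; apply: near_eq_derive; exact: near_open_eq fg Ux.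
Qed.

Lemma Ck_entry (V : normedModType R) m n (U : set V)
    (f : V -> 'M[R]_(m.+1, n.+1)) k i j :
  open U -> Ck k U f -> Ck k U (fun x => f x i j : R).
Proof.
move=> oU; elim: k f => [|k IH] f [cf df];
  have cfij x : U x -> {for x, continuous (fun x => f x i j : R)} by
    (move=> Ux; apply: (@continuous_comp _ _ _ f (fun M : 'M[R]_(_, _) => M i j) x
      (cf _ Ux)); exact: coord_continuous).
  by [].
split=> // v; have [dv cv] := df v; split=> [x Ux|].
  by have /derivable_mxP := dv x Ux; apply.
apply: Ck_ext (IH _ cv) => // x Ux.
by rewrite derive_mx ?mxE//; exact: dv.
Qed.

Lemma Ck_cst (V W : normedModType R) (U : set V) (c : W) k : Ck k U (fun=> c).
Proof.
elim: k c => [|k IH] c; first by split=> // x _; exact: cst_continuous.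
split=> [x _|v]; first exact: cst_continuous.
split=> [x _|]; first exact: derivable_cst.
have -> : (fun x => 'D_v (fun=> c) x) = fun=> 0 :> W.
  by apply: funext => x; rewrite derive_cst.
exact: IH.
Qed.

Lemma Ck_add (V W : normedModType R) (U : set V) (f g : V -> W) k : open U ->
  Ck k U f -> Ck k U g -> Ck k U (fun x => f x + g x).
Proof.
move=> oU; elim: k f g => [|k IH] f g Cf Cg.
  by split=> // x Ux; apply: continuousD; [exact: Cf.1|exact: Cg.1].
split=> [x Ux|v].
  by apply: continuousD; [exact: Cf.1|exact: Cg.1].
have [[df cf] [dg cg]] := (Cf.2 v, Cg.2 v); split=> [x Ux|].
  by apply: derivableD; [exact: df|exact: dg].
apply: Ck_ext (IH _ _ cf cg) => // x Ux.
by rewrite -deriveD//; [exact: df|exact: dg].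
Qed.

Lemma Ck_mul (V : normedModType R) (U : set V) (f g : V -> R) k : open U ->
  Ck k U f -> Ck k U g -> Ck k U (fun x => f x * g x).
Proof.
move=> oU; elim: k f g => [|k IH] f g Cf Cg.
  by split=> // x Ux; apply: continuousM; [exact: Cf.1|exact: Cg.1].
split=> [x Ux|v].
  by apply: continuousM; [exact: Cf.1|exact: Cg.1].
have [[df cf] [dg cg]] := (Cf.2 v, Cg.2 v); split=> [x Ux|].
  by apply: derivableM; [exact: df|exact: dg].
apply: Ck_ext (Ck_add oU (IH _ _ (Ck_le Cf) cg) (IH _ _ (Ck_le Cg) cf)) => // x Ux.
by rewrite deriveM//; [exact: df|exact: dg].
Qed.

Lemma Ck_sum (V : normedModType R) (U : set V) k n (f : 'I_n -> V -> R) : open U ->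
  (forall i, Ck k U (f i)) -> Ck k U (fun x => \sum_(i < n) f i x : R).
Proof.
move=> oU; elim: n f => [|n IH] f Cf.
  have -> : (fun x => \sum_(i < 0) f i x) = fun=> 0 :> R.
    by apply: funext => x; rewrite big_ord0.
  exact: Ck_cst.
have -> : (fun x => \sum_(i < n.+1) f i x) =
    (fun x => f ord0 x + \sum_(i < n) f (lift ord0 i) x).
  by apply: funext => x; rewrite big_ord_recl.
by apply: Ck_add => //; apply: IH.
Qed.

Lemma differentiable_increment (V W : normedModType R) (f : V -> W)
    (df : {linear V -> W}) x : continuous df ->
  (forall e, 0 < e -> \forall h \near (0 : V), `|f (x + h) - f x - df h| <= e * `|h|) ->
  differentiable f x.
Proof.
move=> cdf fx; have df_o : f \o shift x = cst (f x) + df +o_ 0 id.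
  apply/eqaddoP => e /fx; apply: filterS => h.
  by rewrite !fctE /= opprD addrA [h + x]addrC.
by apply/diff_locallyP; rewrite (diff_unique cdf df_o).
Qed.

(** Directional derivatives alone need not be linear in the direction; it is
    differentiability that makes tangent vectors transform linearly. *)
Lemma Ck1_differentiable n (U : set 'rV[R]_n.+1) (f : 'rV[R]_n.+1 -> R) x :
  open U -> Ck 1 U f -> U x -> differentiable f x.
Proof.
move=> oU Cf Ux.
pose df (h : 'rV[R]_n.+1) : R := \sum_(i < n.+1) h 0 i * 'D_(delta_mx 0 i) f x.
have lin_df : linear df.
  move=> a u w; rewrite /df scaler_sumr -big_split/=; apply: eq_bigr => i _.
  by rewrite !mxE mulrDl scalerAl.
pose dfM := GRing.isLinear.Build _ _ _ _ _ lin_df.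
pose dfL : {linear 'rV[R]_n.+1 -> R} := HB.pack df dfM.
have cdf : continuous dfL.
  move=> y; apply: differentiable_continuous.
  rewrite (_ : (dfL : _ -> _) = \sum_(i < n.+1)
      (fun h : 'rV[R]_n.+1 => h 0 i *: 'D_(delta_mx 0 i) f x)); last first.
    by apply: funext => h; rewrite fct_sumE.
  apply: differentiable_sum => i.
  by apply: differentiableZl; exact: differentiable_coord.
apply: (@differentiable_increment _ _ f dfL) => // e e_gt0.
  pose v (i : nat) : 'rV[R]_n.+1 := delta_mx 0 (inord i).
  have e0 : 0 < e / n.+1%:R by rewrite divr_gt0.
  have [d d0 Hd] := Ck1_increment v n.+1 oU Cf Ux e0.
  near=> h.
  pose c i := h 0 (inord i).
  have hn i : `|h 0 i| <= `|h|.
    rewrite [leRHS]/Num.Def.normr/= mx_normrE.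
    exact: (le_bigmax _ (fun ij => `|h ij.1 ij.2|) (0, i)).
  have hE : h = \sum_(i < n.+1) c i *: v i.
    rewrite [LHS]row_sum_delta; apply: eq_bigr => i _.
    by rewrite /c /v inord_val.
  have dfE : df h = \sum_(i < n.+1) c i * 'D_(v i) f x.
    by apply: eq_bigr => i _; rewrite /c /v inord_val.
  rewrite -[dfL h]/(df h) dfE [in x + h]hE.
  rewrite (le_trans (Hd c _))//.
    move=> i; rewrite (le_lt_trans (hn _))//; near: h;
    apply/nbhs_ballP; exists d => //= y; rewrite -ball_normE /= sub0r normrN.
  rewrite mulrAC ler_pdivrMr// -mulrA ler_pM2l// mulr_natr.
  rewrite -[X in _ *+ X](card_ord n.+1) -sumr_const.
  by apply: ler_sum => i _; exact: hn.
Unshelve. all: by end_near. Qed.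

Lemma differentiable_mx (V : normedModType R) n (f : V -> 'rV[R]_n.+1) x :
  (forall j, differentiable (fun y => f y 0 j : R) x) -> differentiable f x.
Proof.
move=> df; rewrite (_ : f = \sum_(j < n.+1) (fun y => f y 0 j *: delta_mx 0 j)).
  by apply: differentiable_sum => j; exact: differentiableZl.
by apply: funext => y; rewrite fct_sumE -row_sum_delta.
Qed.

Lemma Ck1_differentiable_mx m n (U : set 'rV[R]_n.+1) (f : 'rV[R]_n.+1 -> 'rV[R]_m.+1) x :
  open U -> Ck 1 U f -> U x -> differentiable f x.
Proof.
move=> oU Cf Ux; apply: differentiable_mx => j.
by apply: Ck1_differentiable Ux => //; exact: Ck_entry.
Qed.

(** Only the outer map has to be differentiable: along a line the inner one is
    a curve, for which derivable and differentiable coincide. *)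
Lemma is_derive_comp (V W Z : normedModType R) (f : V -> W) (g : W -> Z) x v df :
  is_derive x v f df -> differentiable g (f x) ->
  is_derive x v (g \o f) ('D_df g (f x)).
Proof.
move=> [df_ex df_val] dg.
have f0 : f (0 *: v + x) = f x by rewrite scale0r add0r.
have dfl : differentiable (fun h : R => f (h *: v + x)) 0.
  exact/derivable1_diffP/(derivable1P _ _ _).1.
have dgf : differentiable (g \o (fun h : R => f (h *: v + x))) 0.
  by apply: (differentiable_comp dfl); rewrite f0.
have Dl (T : normedModType R) (k : V -> T) :
    'D_v k x = 'D_1 (fun h : R => k (h *: v + x)) 0.
  have E : (fun h : R => h^-1 *: ((k \o shift x) (h *: v) - k x)) =
      (fun h => h^-1 *: (((fun h : R => k (h *: v + x)) \o shift 0) h%:A -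
                          k (0 *: v + x))).
    by apply: funext => h /=; rewrite addr0 scale0r add0r [h%:A]mulr1.
  by rewrite /derive E.
split; first by apply/derivable1P/derivable1_diffP.
set l := (fun h : R => f (h *: v + x)) in dfl dgf.
have -> : 'D_v (g \o f) x = 'd (g \o l) 0 1 by rewrite Dl deriveE.
have -> : df = 'd l 0 1 by rewrite -df_val Dl deriveE.
have dgl : differentiable g (l 0) by rewrite /l f0.
by rewrite deriveE// (diff_comp dfl)//= /l f0.
Qed.

Lemma derive_linear (V W : normedModType R) (f : V -> W) x a u v :
  differentiable f x -> 'D_(a *: u + v) f x = a *: 'D_u f x + 'D_v f x.
Proof. by move=> df; rewrite !deriveE// linearP. Qed.

End CkMaps.

(** * Matrix valued maps and the Euclidean product *)

Section MxDerive.
Context {R : realType} {V : normedModType R}.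

Lemma is_derive_mxP m n (M : V -> 'M[R]_(m, n)) x v dM :
  is_derive x v M dM <-> forall i j, is_derive x v (fun z => M z i j : R) (dM i j).
Proof.
split=> [[Mx <-] i j|H].
  have /derivable_mxP/(_ i j) Mij := Mx.
  by split=> //; rewrite derive_mx// mxE.
have Mx : derivable M x v by apply/derivable_mxP => i j; case: (H i j).
split=> //; rewrite derive_mx//; apply/matrixP => i j; rewrite mxE.
by case: (H i j).
Qed.

Lemma is_derive_sum_fun n (h : 'I_n -> V -> R) x v dh :
  (forall i, is_derive x v (h i) (dh i)) ->
  is_derive x v (fun z => \sum_(i < n) h i z : R) (\sum_(i < n) dh i).
Proof.
move=> H; have <- : \sum_(i < n) h i = (fun z => \sum_(i < n) h i z).
  by apply: funext => z; rewrite fct_sumE.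
exact: is_derive_sum.
Qed.

Lemma is_derive_mulmx m n p (A : V -> 'M[R]_(m, n)) (B : V -> 'M[R]_(n, p)) x v
    dA dB : is_derive x v A dA -> is_derive x v B dB ->
  is_derive x v (fun z => A z *m B z) (dA *m B x + A x *m dB).
Proof.
move=> /is_derive_mxP HA /is_derive_mxP HB; apply/is_derive_mxP => i j.
have -> : (fun z => (A z *m B z) i j) = fun z => \sum_k A z i k * B z k j.
  by apply: funext => z; rewrite mxE.
have -> : (dA *m B x + A x *m dB) i j =
    \sum_k (A x i k * dB k j + B x k j * dA i k).
  rewrite !mxE -big_split/=; apply: eq_bigr => k _.
  by rewrite addrC [dA _ _ * _]mulrC.
by apply: is_derive_sum_fun => k; exact: (is_deriveM (HA i k) (HB k j)).
Qed.

End MxDerive.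

Section Dot.
Context {R : realType} {n : nat}.
Implicit Types u v w : 'rV[R]_n.

Definition dot u v : R := \sum_i u 0 i * v 0 i.

Lemma dotC u v : dot u v = dot v u.
Proof. by apply: eq_bigr => i _; rewrite mulrC. Qed.

Lemma dotDr u v w : dot u (v + w) = dot u v + dot u w.
Proof. by rewrite /dot -big_split; apply: eq_bigr => i _; rewrite mxE mulrDr. Qed.

Lemma dotZr k u v : dot u (k *: v) = k * dot u v.
Proof. by rewrite /dot mulr_sumr; apply: eq_bigr => i _; rewrite mxE mulrCA. Qed.

Lemma dotNr u v : dot u (- v) = - dot u v.
Proof. by rewrite -scaleN1r dotZr mulN1r. Qed.

Lemma dotBr u v w : dot u (v - w) = dot u v - dot u w.
Proof. by rewrite dotDr dotNr. Qed.

Lemma dot0r u : dot u 0 = 0.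
Proof. by rewrite /dot big1// => i _; rewrite mxE mulr0. Qed.

Lemma dotDl u v w : dot (v + w) u = dot v u + dot w u.
Proof. by rewrite dotC dotDr !(dotC u). Qed.

Lemma dotZl k u v : dot (k *: v) u = k * dot v u.
Proof. by rewrite dotC dotZr dotC. Qed.

Lemma dotNl u v : dot (- v) u = - dot v u.
Proof. by rewrite dotC dotNr dotC. Qed.

Lemma dotBl u v w : dot (v - w) u = dot v u - dot w u.
Proof. by rewrite dotDl dotNl. Qed.

Lemma dot0l u : dot 0 u = 0.
Proof. by rewrite dotC dot0r. Qed.

Lemma dot_ge0 u : 0 <= dot u u.
Proof. by apply: sumr_ge0 => i _; rewrite -expr2 sqr_ge0. Qed.

Lemma dot_eq0 u : (dot u u == 0) = (u == 0).
Proof.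
apply/eqP/eqP => [|->]; last by rewrite dot0l.
move=> u0; apply/rowP => i; rewrite mxE.
have sq_ge0 j : predT j -> 0 <= u 0 j * u 0 j by rewrite -expr2 sqr_ge0.
have /eqP := psumr_eq0P sq_ge0 u0 (isT : predT i).
by rewrite mulf_eq0 orbb => /eqP.
Qed.

Lemma dot_gt0 u : (0 < dot u u) = (u != 0).
Proof. by rewrite lt_neqAle dot_ge0 andbT eq_sym dot_eq0. Qed.

(** The squared norm of (u.u) v - (u.v) u is (u.u) times the defect. *)
Lemma dot_cauchy_schwarz u v : dot u v ^+ 2 <= dot u u * dot v v.
Proof.
have [->|u0] := eqVneq u 0; first by rewrite !dot0l expr0n mul0r.
have uu : 0 < dot u u by rewrite dot_gt0.
have := dot_ge0 (dot u u *: v - dot u v *: u).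
rewrite dotBl !dotBr !dotZl !dotZr (dotC v u).
set a := dot u u; set b := dot u v; set c := dot v v => H.
have : 0 <= a * (a * c - b ^+ 2) by lra.
by rewrite pmulr_rge0// subr_ge0.
Qed.

End Dot.

Section ScalarComp.
Context {R : realType} {V : normedModType R}.

Lemma is_derive_comp_scalar (f : V -> R) (g : R -> R) x v df dg :
  is_derive x v f df -> is_derive (f x) 1 g dg ->
  is_derive x v (fun z => g (f z)) (dg * df).
Proof.
move=> Hf [g1 <-].
have dg' : differentiable g (f x) by exact/derivable1_diffP.
have H := is_derive_comp Hf dg'; apply: is_derive_eq H _.
by rewrite !deriveE// -[X in 'd _ _ X = _]mulr1 linearZ/= mulrC.
Qed.
End ScalarComp.

(** * The Minkowski norm of an (alpha,beta)-metric *)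

Section AlphaBeta.
Context {R : realType} {n : nat}.
Variables (X : 'rV[R]_n) (phi phi1 phi2 : R -> R).
Implicit Types u w q : 'rV[R]_n.

Definition enorm u : R := Num.sqrt (dot u u).
(** The argument s = beta / alpha of phi. *)
Definition slope u : R := dot X u / enorm u.
Definition ab_norm u : R := enorm u * phi (slope u).
(** In what follows [phi1] and [phi2] stand for the first two derivatives of
    [phi]. *)
Definition kappa (s : R) : R := phi s - s * phi1 s.
Definition dslope u w : R := dot X w / enorm u - dot X u * dot u w / enorm u ^+ 3.
(** With alpha ds = dbeta - s dalpha, the differential of alpha phi(s) is
    kappa(s) dalpha + phi'(s) dbeta. *)
Definition ab_diff u w : R :=
  kappa (slope u) * (dot u w / enorm u) + phi1 (slope u) * dot X w.
(** In the differential of kappa(s) dalpha + phi'(s) dbeta the variation of s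
    contributes phi'' ds (dbeta - s dalpha) = phi'' alpha ds ds, because
    kappa' = - s phi''. *)
Definition ab_hess u w q : R :=
  kappa (slope u) * (dot w q / enorm u - dot u w * dot u q / enorm u ^+ 3)
  + phi2 (slope u) * enorm u * dslope u w * dslope u q.

Lemma sqr_enorm u : enorm u ^+ 2 = dot u u.
Proof. by rewrite sqr_sqrtr// dot_ge0. Qed.

Lemma enorm_gt0 u : u != 0 -> 0 < enorm u.
Proof. by move=> u0; rewrite sqrtr_gt0 dot_gt0. Qed.

Lemma enorm_ge0 u : 0 <= enorm u. Proof. exact: sqrtr_ge0. Qed.

Lemma norm_dot_le u w : `|dot u w| <= enorm u * enorm w.
Proof.
rewrite -(@ler_pXn2r _ 2) ?nnegrE ?mulr_ge0 ?enorm_ge0//.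
by rewrite real_normK ?num_real// exprMn !sqr_enorm dot_cauchy_schwarz.
Qed.

(** Keeps s in the range where the derivatives of phi are controlled. *)
Lemma norm_slope_le u : `|slope u| <= enorm X.
Proof.
have [->|u0] := eqVneq u 0; first by rewrite /slope dot0r mul0r normr0 enorm_ge0.
rewrite /slope normrM normfV (ger0_norm (enorm_ge0 u)) ler_pdivrMr ?enorm_gt0//.
exact: norm_dot_le.
Qed.

Hypothesis dphi : forall s : R, `|s| <= enorm X -> is_derive s 1 phi (phi1 s).
Hypothesis dphi1 : forall s : R, `|s| <= enorm X -> is_derive s 1 phi1 (phi2 s).

Context {V : normedModType R}.
Variables (theta eta : V -> 'rV[R]_n) (x v : V) (dtheta deta : 'rV[R]_n).
Hypothesis Htheta : is_derive x v theta dtheta.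
Hypothesis Heta : is_derive x v eta deta.
Hypothesis theta0 : theta x != 0.

Lemma is_derive_dot (f g : V -> 'rV[R]_n) df dg :
  is_derive x v f df -> is_derive x v g dg ->
  is_derive x v (fun z => dot (f z) (g z)) (dot df (g x) + dot (f x) dg).
Proof.
move=> /is_derive_mxP Hf /is_derive_mxP Hg.
rewrite /dot -big_split/=; apply: is_derive_sum_fun => i.
apply: (is_derive_eq (is_deriveM (Hf 0 i) (Hg 0 i))).
by rewrite addrC [df 0 i * _]mulrC.
Qed.

Lemma is_derive_enorm :
  is_derive x v (fun z => enorm (theta z)) (dot (theta x) dtheta / enorm (theta x)).
Proof.
have Hd := is_derive_dot Htheta Htheta.
have uu : 0 < dot (theta x) (theta x) by rewrite dot_gt0.
have H := is_derive_comp_scalar Hd (is_derive1_sqrt uu).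
apply: is_derive_eq H _.
rewrite -/(enorm _) (dotC dtheta); field.
by rewrite gt_eqF// enorm_gt0.
Qed.

Lemma is_derive_dotX (g : V -> 'rV[R]_n) dg : is_derive x v g dg ->
  is_derive x v (fun z => dot X (g z)) (dot X dg).
Proof.
move=> Hg; apply: (is_derive_eq (is_derive_dot (is_derive_cst X x v) Hg)).
by rewrite dot0l add0r.
Qed.

Lemma is_derive_enormV : is_derive x v (fun z => (enorm (theta z))^-1)
  (- (dot (theta x) dtheta / enorm (theta x) ^+ 3)).
Proof.
have n0 : enorm (theta x) != 0 by rewrite gt_eqF// enorm_gt0.
have Hi : is_derive (enorm (theta x)) 1 (fun r : R => r^-1) (- enorm (theta x) ^- 2).
  apply: (is_derive_eq (is_deriveV _ (is_derive_id _ _))) => //.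
  by rewrite /GRing.scale/= mulr1.
apply: (is_derive_eq (is_derive_comp_scalar is_derive_enorm Hi)).
move: (enorm _) n0 (dot _ _) => r r0 d; field.
by [].
Qed.

Lemma is_derive_slope :
  is_derive x v (fun z => slope (theta z)) (dslope (theta x) dtheta).
Proof.
apply: (is_derive_eq (is_deriveM (is_derive_dotX Htheta) is_derive_enormV)).
by rewrite /dslope /GRing.scale/=; ring.
Qed.

(** Stated along an arbitrary map [theta] rather than along a line, so that it
    serves both for the derivatives in the fibre and for those in the base. *)
Lemma is_derive_ab_norm :
  is_derive x v (fun z => ab_norm (theta z)) (ab_diff (theta x) dtheta).
Proof.
have n0 : enorm (theta x) != 0 by rewrite gt_eqF// enorm_gt0.
have Hp := is_derive_comp_scalar is_derive_slope (dphi (norm_slope_le (theta x))).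
apply: (is_derive_eq (is_deriveM is_derive_enorm Hp)).
rewrite /ab_diff /dslope /kappa /GRing.scale/= /slope.
set s := dot X (theta x) / _.
have -> : dot X (theta x) = s * enorm (theta x) by rewrite mulfVK.
by field.
Qed.

(** The moving vector [eta] is needed because the base derivative of F^2 produces
    a vector that depends on y. *)
Lemma is_derive_ab_diff : is_derive x v (fun z => ab_diff (theta z) (eta z))
  (ab_hess (theta x) (eta x) dtheta + ab_diff (theta x) deta).
Proof.
have n0 : enorm (theta x) != 0 by rewrite gt_eqF// enorm_gt0.
have Hp := is_derive_comp_scalar is_derive_slope (dphi (norm_slope_le (theta x))).
have Hp1 := is_derive_comp_scalar is_derive_slope (dphi1 (norm_slope_le (theta x))).
have Hk := is_deriveB Hp (is_deriveM is_derive_slope Hp1).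
have Hd := is_deriveM (is_derive_dot Htheta Heta) is_derive_enormV.
have H := is_deriveD (is_deriveM Hk Hd) (is_deriveM Hp1 (is_derive_dotX Heta)).
apply: (is_derive_eq H).
rewrite /ab_hess /ab_diff /kappa /GRing.scale/= !fctE /dslope.
set t := slope _.
have tE : dot X (theta x) = t * enorm (theta x) by rewrite /t /slope mulfVK.
rewrite tE (dotC dtheta).
move: (enorm _) n0 (dot _ _) (dot _ _) (dot _ _) (dot _ _) (dot _ _) (dot _ _)
  (dot _ _) (phi t) (phi1 t) (phi2 t) => r r0 d0 d1 d2 d3 d4 d5 d6 p p1 p2.
by field.
Qed.

End AlphaBeta.

Section Scalar.
Context {R : realType} {n : nat}.

(** Reassembles the index sums of the spray formula into values of forms. *)
Lemma scalar_sum_delta (f : 'rV[R]_n -> R) (w : 'rV[R]_n) : scalar f ->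
  f w = \sum_i w 0 i * f (delta_mx 0 i).
Proof.
move=> fL; pose fM := GRing.isLinear.Build _ _ _ _ _ fL.
pose g : {scalar 'rV[R]_n} := HB.pack f fM.
rewrite [in LHS](row_sum_delta w) -[f _]/(g _) linear_sum.
by apply: eq_bigr => i _; exact: (linearZ_LR g).
Qed.

Lemma scalar_add (f : 'rV[R]_n -> R) (u v : 'rV[R]_n) : scalar f ->
  f (u + v) = f u + f v.
Proof. by move=> fL; rewrite -[u in LHS]scale1r fL mul1r. Qed.

Lemma scalar_scale (f : 'rV[R]_n -> R) (k : R) (u : 'rV[R]_n) : scalar f ->
  f (k *: u) = k * f u.
Proof.
move=> fL; have f0 : f 0 = 0.
  by apply: (addrI (f 0)); rewrite addr0 -scalar_add// addr0.
by rewrite -[k *: u]addr0 fL f0 addr0.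
Qed.

Lemma is_derive_sqr (V : normedModType R) (f : V -> R) x v df :
  is_derive x v f df -> is_derive x v (fun z => f z ^+ 2) (2 * f x * df).
Proof.
move=> Hf; have -> : (fun z => f z ^+ 2) = f * f.
  by apply: funext => z; rewrite expr2.
apply: (is_derive_eq (is_deriveM Hf Hf)).
by rewrite /GRing.scale/=; ring.
Qed.

Lemma near_neq0 (V : normedModType R) (y : V) : y != 0 -> \forall z \near y, z != 0.
Proof.
move=> y0; have : \forall z \near y, `|y - z| < `|y|.
  apply/nbhs_ballP; exists `|y|; first by rewrite /= normr_gt0.
  by move=> z; rewrite -ball_normE.
by apply: filterS => z; apply: contraTneq => ->; rewrite subr0 ltxx.
Qed.

End Scalar.

Section AlphaBetaAlgebra.
Context {R : realType} {n : nat}.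
Variables (X : 'rV[R]_n) (phi phi1 phi2 : R -> R).
Implicit Types u w q : 'rV[R]_n.
Local Notation N := (ab_norm X phi).
Local Notation dN := (ab_diff X phi phi1).
Local Notation d2N := (ab_hess X phi phi1 phi2).
Local Notation dslope := (dslope X).

Lemma ab_diff_scalar u : scalar (dN u).
Proof. by move=> k w q; rewrite /ab_diff !dotDr !dotZr; ring. Qed.

Lemma ab_diff0 u : dN u 0 = 0.
Proof. by rewrite /ab_diff !dot0r; ring. Qed.

Lemma dslope_scalar u : scalar (dslope u).
Proof. by move=> k w q; rewrite /dslope !dotDr !dotZr; ring. Qed.

Lemma ab_hessC u w q : d2N u w q = d2N u q w.
Proof. by rewrite /ab_hess (dotC w q); ring. Qed.

Lemma ab_hess_scalar u w : scalar (d2N u w).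
Proof. by move=> k q q'; rewrite /ab_hess dslope_scalar !dotDr !dotZr; ring. Qed.

Lemma ab_diff_self u : u != 0 -> dN u u = N u.
Proof.
move=> u0; have n0 : enorm u != 0 by rewrite gt_eqF// enorm_gt0.
rewrite /ab_diff /ab_norm /kappa -sqr_enorm /slope.
move: (phi _) (phi1 _) => p p1; move: (dot _ _) (enorm u) n0 => d r r0.
by field.
Qed.

Lemma ab_hess_self u w : u != 0 -> d2N u u w = 0.
Proof.
move=> u0; have n0 : enorm u != 0 by rewrite gt_eqF// enorm_gt0.
rewrite /ab_hess /dslope -sqr_enorm.
move: (kappa _ _ _) (phi2 _) => p p1.
move: (dot _ _) (dot _ _) (enorm u) n0 => d d' r r0.
by field.
Qed.

Definition ab_sqr_diff u w : R := 2 * N u * dN u w.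
Definition ab_sqr_hess u w q : R := 2 * dN u q * dN u w + 2 * N u * d2N u w q.

Lemma ab_sqr_diff_scalar u : scalar (ab_sqr_diff u).
Proof. by move=> k w q; rewrite /ab_sqr_diff ab_diff_scalar; ring. Qed.

Lemma ab_sqr_hessC u w q : ab_sqr_hess u w q = ab_sqr_hess u q w.
Proof. by rewrite /ab_sqr_hess ab_hessC; ring. Qed.

Lemma ab_sqr_hess_scalar u w : scalar (ab_sqr_hess u w).
Proof. by move=> k q q'; rewrite /ab_sqr_hess ab_hess_scalar ab_diff_scalar; ring. Qed.

Lemma ab_sqr_hess_scalarl u w : scalar (fun q => ab_sqr_hess u q w).
Proof. by move=> k q q'; rewrite !(ab_sqr_hessC u _ w) ab_sqr_hess_scalar. Qed.

Hypothesis dphi : forall s : R, `|s| <= enorm X -> is_derive s 1 phi (phi1 s).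
Hypothesis dphi1 : forall s : R, `|s| <= enorm X -> is_derive s 1 phi1 (phi2 s).

Lemma is_derive_ab_sqr_diff (V : normedModType R) (theta eta : V -> 'rV[R]_n) x v dtheta deta :
  is_derive x v theta dtheta -> is_derive x v eta deta -> theta x != 0 ->
  is_derive x v (fun z => ab_sqr_diff (theta z) (eta z))
    (ab_sqr_hess (theta x) (eta x) dtheta + ab_sqr_diff (theta x) deta).
Proof.
move=> Ht He t0.
have HN := is_derive_ab_norm dphi Ht t0.
have HdN := is_derive_ab_diff dphi dphi1 Ht He t0.
have -> : (fun z => ab_sqr_diff (theta z) (eta z)) =
    (cst 2 * (fun z => N (theta z))) * (fun z => dN (theta z) (eta z)) by [].
apply: (is_derive_eq (is_deriveM (is_deriveM (is_derive_cst (2 : R) x v) HN) HdN)).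
by rewrite /GRing.scale/= !fctE /ab_sqr_hess /ab_sqr_diff; ring.
Qed.

End AlphaBetaAlgebra.

(** * The spray in a moving frame *)

Section Spray.
Context {R : realType} {n : nat} {M : topologicalType}.
Local Notation E := 'rV[R]_n.+1.
Variables (S : smooth_structure R n M) (F : forall p : M, tangent R n p -> R)
  (c : chart R n M) (x0 : E).
Variables (X : E) (phi phi1 phi2 : R -> R) (A DA : E -> 'M[R]_n.+1) (B0 : 'M[R]_n.+1).
Hypothesis dphi : forall s : R, `|s| <= enorm X -> is_derive s 1 phi (phi1 s).
Hypothesis dphi1 : forall s : R, `|s| <= enorm X -> is_derive s 1 phi1 (phi2 s).
Hypothesis dA : forall v, is_derive x0 v A (DA v).
Hypothesis AB : A x0 *m B0 = 1%:M.
Hypothesis FE : \forall x \near x0, forall y : E,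
  coord_expr S F c x y = ab_norm X phi (y *m A x).
Local Notation A0 := (A x0).
Local Notation N := (ab_norm X phi).
Local Notation dN := (ab_diff X phi phi1).
Local Notation d2N := (ab_hess X phi phi1 phi2).
Local Notation dH := (ab_sqr_diff X phi phi1).
Local Notation d2H := (ab_sqr_hess X phi phi1 phi2).

Lemma mulA0_neq0 (y : E) : y != 0 -> y *m A0 != 0.
Proof.
by apply: contraNneq => yA; rewrite -[y]mulmx1 -AB mulmxA yA mul0mx.
Qed.

Lemma is_derive_mulmxr (P : 'M[R]_n.+1) (y v : E) :
  is_derive y v (fun z : E => z *m P) (v *m P).
Proof.
apply: (is_derive_eq (is_derive_mulmx (is_derive_id y v) (is_derive_cst P y v))).
by rewrite mulmx0 addr0.
Qed.

Lemma is_derive_mulmxA (y v : E) :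
  is_derive x0 v (fun x => y *m A x) (y *m DA v).
Proof.
apply: (is_derive_eq (is_derive_mulmx (is_derive_cst y x0 v) (dA v))).
by rewrite mul0mx add0r.
Qed.

Lemma derive_y (y v : E) : y != 0 ->
  'D_v (fun y' : E => coord_expr S F c x0 y' ^+ 2 : R) y = dH (y *m A0) (v *m A0).
Proof.
move=> y0; have -> : (fun y' : E => coord_expr S F c x0 y' ^+ 2 : R) =
    (fun y' : E => N (y' *m A0) ^+ 2).
  by apply: funext => y'; rewrite (nbhs_singleton FE).
apply: derive_val; apply: is_derive_sqr.
exact: (is_derive_ab_norm dphi (is_derive_mulmxr A0 y v) (mulA0_neq0 y0)).
Qed.

Lemma derive_x (y v : E) : y != 0 ->
  'D_v (fun x : E => coord_expr S F c x y ^+ 2 : R) x0 =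
  dH (y *m A0) (y *m DA v).
Proof.
move=> y0; rewrite (@near_eq_derive _ _ _ _ (fun x : E => N (y *m A x) ^+ 2)).
  apply: derive_val; apply: is_derive_sqr.
  exact: (is_derive_ab_norm dphi (is_derive_mulmxA y v) (mulA0_neq0 y0)).
by apply: filterS FE => x ->.
Qed.

Lemma fundamental_tensorE (y : E) i j : y != 0 ->
  fundamental_tensor S F c x0 y i j =
  2^-1 * d2H (y *m A0) (delta_mx 0 j *m A0) (delta_mx 0 i *m A0).
Proof.
move=> y0; rewrite mxE; congr (_ * _).
rewrite (@near_eq_derive _ _ _ _ (fun y' : E => dH (y' *m A0) (delta_mx 0 j *m A0))).
  apply: derive_val; apply: is_derive_eq.
    exact: (is_derive_ab_sqr_diff dphi dphi1 (is_derive_mulmxr A0 y _)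
      (is_derive_cst _ y _) (mulA0_neq0 y0)).
  by rewrite /ab_sqr_diff ab_diff0 mulr0 addr0.
by apply: filterS (near_neq0 y0) => y'; exact: derive_y.
Qed.

Lemma derive_yx (y v w : E) : y != 0 ->
  'D_w (fun y' : E => 'D_v (fun x : E => coord_expr S F c x y' ^+ 2 : R) x0) y =
  d2H (y *m A0) (y *m DA v) (w *m A0) + dH (y *m A0) (w *m DA v).
Proof.
move=> y0.
rewrite (@near_eq_derive _ _ _ _ (fun y' : E => dH (y' *m A0) (y' *m DA v))).
  apply: derive_val.
  exact: (is_derive_ab_sqr_diff dphi dphi1 (is_derive_mulmxr A0 y _)
      (is_derive_mulmxr _ y _) (mulA0_neq0 y0)).
by apply: filterS (near_neq0 y0) => y'; exact: derive_x.
Qed.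

Hypothesis DA_linear : linear DA.
Hypothesis phi_gt0 : forall s : R, `|s| <= enorm X -> 0 < phi s.
Hypothesis g_pos : forall y : E, y != 0 -> forall v : E, v != 0 ->
  0 < (v *m fundamental_tensor S F c x0 y *m v^T) 0 0.

Lemma fundamental_tensor_unit (y : E) : y != 0 ->
  fundamental_tensor S F c x0 y \in unitmx.
Proof.
move=> y0; rewrite -row_free_unit -kermx_eq0; apply/rowV0P => v /sub_kermxP vg.
apply/eqP; apply: contraT => v0; have := g_pos y0 v0.
by rewrite vg mul0mx mxE ltxx.
Qed.

Lemma ab_norm_gt0 u : u != 0 -> 0 < N u.
Proof. by move=> u0; rewrite mulr_gt0 ?enorm_gt0// phi_gt0// norm_slope_le. Qed.

(** The definition of the spray, with the inverse of the fundamental tensor cleared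
    and the free index contracted with w. *)
Lemma spray_eq (y w : E) : y != 0 ->
  let s := \row_i spray_coef S F c x0 y i in
  2 * d2H (y *m A0) (w *m A0) (s *m A0) =
  d2H (y *m A0) (w *m A0) (y *m DA y) +
  dH (y *m A0) (w *m DA y) - dH (y *m A0) (y *m DA w).
Proof.
move=> y0 s.
pose g := fundamental_tensor S F c x0 y.
pose r : E := \row_l (d2H (y *m A0) (y *m DA y) (delta_mx 0 l *m A0) +
  dH (y *m A0) (delta_mx 0 l *m DA y) -
  dH (y *m A0) (y *m DA (delta_mx 0 l))).
have sr : s = 4^-1 *: (r *m (invmx g)^T).
  apply/rowP => i; rewrite !mxE; congr (_ * _); apply: eq_bigr => l _.
  rewrite mulrC [(invmx g)^T _ _]mxE; congr (_ * _).
  rewrite (derive_x _ y0) [r 0 l]mxE; congr (_ - _).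
  pose f v := d2H (y *m A0) (y *m DA v) (delta_mx 0 l *m A0)
    + dH (y *m A0) (delta_mx 0 l *m DA v).
  have fL : scalar f.
    move=> a u v; rewrite /f DA_linear !mulmxDr -!scalemxAr.
    rewrite ab_sqr_hess_scalarl ab_sqr_diff_scalar.
    by move: (d2H _ _ _) (d2H _ _ _) (dH _ _) (dH _ _) => p q p' q'; ring.
  rewrite -/(f y) (scalar_sum_delta y fL); apply: eq_bigr => m _.
  by rewrite (derive_yx _ _ y0) mulrC.
have gs : s *m g^T = 4^-1 *: r.
  rewrite sr -scalemxAl -mulmxA -trmx_mul mulmxV ?trmx1 ?mulmx1//.
  exact: fundamental_tensor_unit.
have gsw : (s *m g^T *m w^T) 0 0 = 2^-1 * d2H (y *m A0) (w *m A0) (s *m A0).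
  pose f1 w := d2H (y *m A0) (w *m A0) (s *m A0).
  have f1L : scalar f1.
    by move=> a u v; rewrite /f1 mulmxDl -scalemxAl ab_sqr_hess_scalarl.
  rewrite -/(f1 w) (scalar_sum_delta w f1L) mulr_sumr mxE.
  apply: eq_bigr => l _; rewrite [w^T _ _]mxE mulrC mulrCA; congr (_ * _).
  pose f2 v := d2H (y *m A0) (delta_mx 0 l *m A0) (v *m A0).
  have f2L : scalar f2.
    by move=> a u v; rewrite /f2 mulmxDl -scalemxAl ab_sqr_hess_scalar.
  rewrite /f1 -/(f2 s) (scalar_sum_delta s f2L) mulr_sumr mxE.
  apply: eq_bigr => i _; rewrite [g^T _ _]mxE mulrCA; congr (_ * _).
  by rewrite (fundamental_tensorE _ _ y0) ab_sqr_hessC.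
have rw : (r *m w^T) 0 0 = d2H (y *m A0) (w *m A0) (y *m DA y) +
  dH (y *m A0) (w *m DA y) - dH (y *m A0) (y *m DA w).
  pose f w := d2H (y *m A0) (w *m A0) (y *m DA y) +
  dH (y *m A0) (w *m DA y) - dH (y *m A0) (y *m DA w).
  have fL : scalar f.
    move=> a u v; rewrite /f DA_linear !mulmxDl !mulmxDr -!scalemxAl -!scalemxAr.
    rewrite ab_sqr_hess_scalarl !ab_sqr_diff_scalar opprD.
    move: (d2H _ _ _) (d2H _ _ _) (dH _ _) (dH _ _) (dH _ _) (dH _ _) => p q p' q' p'' q''.
    by ring.
  rewrite -/(f w) (scalar_sum_delta w fL) mxE.
  by apply: eq_bigr => l _; rewrite !mxE mulrC /f ab_sqr_hessC.
rewrite -rw; move: gsw; rewrite gs -scalemxAl mxE => /(congr1 (fun z => 4 * z)).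
by rewrite mulrA divff ?pnatr_eq0// mul1r => ->; field.
Qed.

Variable br : E -> E -> E.
Hypothesis structure_eq : forall u z : E,
  z *m B0 *m DA (u *m B0) - u *m B0 *m DA (z *m B0) = br z u.
Variables (Gamma : 'I_n.+1 -> 'I_n.+1 -> 'I_n.+1 -> R) (P : E -> R).
Hypothesis douglas : forall y i, y != 0 -> spray_coef S F c x0 y i =
  2^-1 * (\sum_j \sum_k Gamma i j k * y 0 j * y 0 k) + P y * y 0 i.

(** Rewriting the right side of [spray_eq] by the structure equations leaves
    d^2(N^2)_u (z, q + 2 P u) = d(N^2)_u ([z, u]), where q is quadratic in u.
    By homogeneity z = u gives dN_u(q) + 2 P N = 0; substituting this back
    removes P together with all the first order terms. *)
Lemma douglas_projective : exists Q : E -> E -> E,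
  [/\ forall u, linear (Q u), forall u, linear (Q^~ u)
    & forall u z, u != 0 -> d2N u z (Q u u) = dN u (br z u)].
Proof.
pose G (u v : E) : E := \row_i \sum_j \sum_k Gamma i j k * u 0 j * v 0 k.
exists (fun u v => G (u *m B0) (v *m B0) *m A0 - u *m B0 *m DA (v *m B0)).
have Gr u : linear (G u).
  move=> a v w; apply/rowP => i; rewrite !mxE mulr_sumr -big_split/=.
  apply: eq_bigr => j _; rewrite mulr_sumr -big_split/=.
  by apply: eq_bigr => k _; rewrite !mxE; ring.
have Gl u : linear (G^~ u).
  move=> a v w; apply/rowP => i; rewrite !mxE mulr_sumr -big_split/=.
  apply: eq_bigr => j _; rewrite mulr_sumr -big_split/=.
  by apply: eq_bigr => k _; rewrite !mxE; ring.
split=> [u a v w|u a v w|u z u0].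
- rewrite mulmxDl -scalemxAl Gr DA_linear mulmxDl mulmxDr -scalemxAl -scalemxAr.
  by rewrite scalerBr opprD addrACA.
- rewrite /= mulmxDl -scalemxAl Gl !mulmxDl -!scalemxAl.
  by rewrite scalerBr opprD addrACA.
have BA : B0 *m A0 = 1%:M by exact: mulmx1C.
have [y yE] : exists y, y = u *m B0 by exists (u *m B0).
have yA : y *m A0 = u by rewrite yE -mulmxA BA mulmx1.
have y0 : y != 0 by apply: contraNneq u0 => y0; rewrite -yA y0 mul0mx.
set q := _ - _.
have sE : 2 *: (\row_i spray_coef S F c x0 y i *m A0) =
    q + y *m DA y + (2 * P y) *: u.
  rewrite /q -yE subrK.
  have -> : \row_i spray_coef S F c x0 y i = 2^-1 *: G y y + P y *: y.
    by apply/rowP => i; rewrite !mxE douglas.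
  rewrite mulmxDl -!scalemxAl yA scalerDr !scalerA divff ?pnatr_eq0//.
  by rewrite scale1r.
have d2H_lin w := @ab_sqr_hess_scalar _ _ X phi phi1 phi2 u w.
have dN_lin := @ab_diff_scalar _ _ X phi phi1 u.
have d2N_lin w := @ab_hess_scalar _ _ X phi phi1 phi2 u w.
have key w : d2H u w (q + (2 * P y) *: u) = dH u (br w u).
  have H : d2H u w (q + y *m DA y + (2 * P y) *: u) =
      d2H u w (y *m DA y) + dH u (w *m B0 *m DA y) - dH u (y *m DA (w *m B0)).
    rewrite -sE (scalar_scale _ _ (d2H_lin w)).
    have := spray_eq (w *m B0) y0.
    by rewrite /= -[w *m B0 *m A0]mulmxA BA mulmx1 yA.
  have := structure_eq u w; rewrite -yE => <-.
  have dH_lin := @ab_sqr_diff_scalar _ _ X phi phi1 u.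
  rewrite (scalar_add _ _ dH_lin) -scaleN1r (scalar_scale _ _ dH_lin).
  move: H; rewrite !(scalar_add _ _ (d2H_lin w)).
  move: (d2H _ _ _) (d2H _ _ _) (d2H _ _ _) (dH _ _) (dH _ _) => d1 d2 d3 d4 d5.
  by move=> H; lra.
have N0 := ab_norm_gt0 u0.
have key2 w : 2 * (dN u q + 2 * P y * N u) * dN u w + 2 * N u * d2N u w q =
    2 * N u * dN u (br w u).
  have := key w; rewrite /ab_sqr_hess /ab_sqr_diff.
  rewrite (scalar_add _ _ dN_lin) (scalar_scale _ _ dN_lin).
  rewrite (scalar_add _ _ (d2N_lin w)) (scalar_scale _ _ (d2N_lin w)).
  by rewrite (ab_hessC _ _ _ _ u w u) ab_hess_self// ab_diff_self// mulr0 addr0.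
have bruu : br u u = 0 by rewrite -structure_eq subrr.
have Pq : dN u q + 2 * P y * N u = 0.
  have := key2 u; rewrite bruu ab_diff0 mulr0 ab_hess_self// mulr0 addr0 ab_diff_self// => H.
  apply: (@mulIf _ (N u)); first by rewrite gt_eqF.
  apply: (@mulfI _ 2); first by rewrite pnatr_eq0.
  by rewrite mul0r mulr0 mulrA.
have := key2 z; rewrite Pq mulr0 mul0r add0r.
by apply: mulfI; rewrite mulf_neq0 ?pnatr_eq0// gt_eqF.
Qed.
End Spray.

(** * Charts and tangent vectors *)

Section Slices.
Context {R : realType} {V W Z : normedModType R}.
Implicit Types f : V * W -> Z.

(** Difference quotients in a direction tangent to a factor are those of the
    slice. *)
Lemma growth_pair_l f x y v :
  (fun h : R => h^-1 *: ((f \o shift (x, y)) (h *: (v, 0)) - f (x, y))) =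
  (fun h => h^-1 *: (((fun z => f (z, y)) \o shift x) (h *: v) - f (x, y))).
Proof.
apply: funext => h /=; congr (_ *: (f _ - _)).
by congr pair; rewrite /= ?scaler0 ?add0r.
Qed.

Lemma growth_pair_r f x y v :
  (fun h : R => h^-1 *: ((f \o shift (x, y)) (h *: (0, v)) - f (x, y))) =
  (fun h => h^-1 *: (((fun z => f (x, z)) \o shift y) (h *: v) - f (x, y))).
Proof.
apply: funext => h /=; congr (_ *: (f _ - _)).
by congr pair; rewrite /= ?scaler0 ?add0r.
Qed.

Lemma derive_pair_l f x y v : 'D_(v, 0) f (x, y) = 'D_v (fun z => f (z, y)) x.
Proof. by rewrite /derive growth_pair_l. Qed.

Lemma derive_pair_r f x y v : 'D_(0, v) f (x, y) = 'D_v (fun z => f (x, z)) y.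
Proof. by rewrite /derive growth_pair_r. Qed.

Lemma Ck_slice_l k (D : set (V * W)) f y : Ck k D f ->
  Ck k [set x | D (x, y)] (fun x => f (x, y)).
Proof.
elim: k f => [|k IH] f [cf df].
  split=> // x Dx; apply: (@continuous_comp _ _ _ (fun x => (x, y)) f).
    by apply: cvg_pair; [exact: cvg_id|exact: cvg_cst].
  exact: cf.
split=> [x Dx|v].
  apply: (@continuous_comp _ _ _ (fun x => (x, y)) f).
    by apply: cvg_pair; [exact: cvg_id|exact: cvg_cst].
  exact: cf.
have [dv cv] := df (v, 0); split=> [x Dx|].
  by have := dv _ Dx; rewrite /derivable growth_pair_l.
have -> : (fun x => 'D_v (fun z => f (z, y)) x) = (fun x => 'D_(v, 0) f (x, y)).
  by apply: funext => x; rewrite derive_pair_l.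
exact: (IH (fun z => 'D_(v, 0) f z) cv).
Qed.

Lemma Ck_slice_r k (D : set (V * W)) f x : Ck k D f ->
  Ck k [set y | D (x, y)] (fun y => f (x, y)).
Proof.
elim: k f => [|k IH] f [cf df].
  split=> // y Dx; apply: (@continuous_comp _ _ _ (fun y => (x, y)) f).
    by apply: cvg_pair; [exact: cvg_cst|exact: cvg_id].
  exact: cf.
split=> [y Dx|v].
  apply: (@continuous_comp _ _ _ (fun y => (x, y)) f).
    by apply: cvg_pair; [exact: cvg_cst|exact: cvg_id].
  exact: cf.
have [dv cv] := df (0, v); split=> [y Dx|].
  by have := dv _ Dx; rewrite /derivable growth_pair_r.
have -> : (fun y => 'D_v (fun z => f (x, z)) y) = (fun y => 'D_(0, v) f (x, y)).
  by apply: funext => y; rewrite derive_pair_r.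
exact: (IH (fun z => 'D_(0, v) f z) cv).
Qed.

Lemma Ck_sub k (U U' : set V) (g : V -> Z) : U' `<=` U -> Ck k U g -> Ck k U' g.
Proof.
move=> UU'; elim: k g => [|k IH] g [cg dg]; first by split=> // x /UU'/cg.
split=> [x /UU'/cg//|v]; have [dv cv] := dg v.
by split; [move=> x /UU'/dv|exact: IH].
Qed.

Lemma open_slice_r (D : set (V * W)) x : open D -> open [set y | D (x, y)].
Proof.
move=> oD; apply: (@open_comp _ _ (fun y => (x, y)) D) => // y _.
by apply: cvg_pair; [exact: cvg_cst|exact: cvg_id].
Qed.

End Slices.

Section Charts.
Context {R : realType} {n : nat} {M : topologicalType}.
Local Notation E := 'rV[R]_n.+1.
Variable S : smooth_structure R n M.
Implicit Types (c : chart R n M) (p : M) (x y v : E).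

Lemma chart_invK c x : chart_img c x -> c (chart_inv c x) = x.
Proof. by move=> [p cp <-]; rewrite chart_mapK. Qed.

Lemma chart_inv_dom c x : chart_img c x -> chart_dom c (chart_inv c x).
Proof. by move=> [p cp <-]; rewrite chart_mapK. Qed.

Lemma chart_img_map c p : chart_dom c p -> chart_img c (c p).
Proof. by move=> cp; exists p. Qed.

Lemma near_overlap c c' p : chart_dom c p -> chart_dom c' p ->
  \forall x \near c p, chart_img c x /\ chart_dom c' (chart_inv c x).
Proof.
move=> cp c'p; apply: filterI.
  by apply: open_nbhs_nbhs; split; [exact: chart_img_open|exact: chart_img_map].
have /(_ (chart_dom c')) := @chart_inv_cont _ _ _ c _ (chart_img_map cp).
apply; rewrite chart_mapK//.
by apply: open_nbhs_nbhs; split; [exact: chart_dom_open|].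
Qed.

Lemma open_overlap c c' : open (c @` (chart_dom c `&` chart_dom c')).
Proof.
rewrite openE => x [p [cp c'p] <-]; rewrite /interior/=.
apply: filterS (near_overlap cp c'p) => z [cz c'z].
by exists (chart_inv c z); [split=> //; exact: chart_inv_dom|exact: chart_invK].
Qed.

Lemma transition_differentiable c c' p : atlas S c -> atlas S c' ->
  chart_dom c p -> chart_dom c' p -> differentiable (c' \o chart_inv c) (c p).
Proof.
move=> Sc Sc' cp c'p.
have /(_ 1%N) cC := @atlas_compatible _ _ _ S c c' Sc Sc'.
by apply: (Ck1_differentiable_mx (@open_overlap c c') cC); exists p.
Qed.

(** The chain rule for a transition map and its inverse: changing components from
    one chart to another and back is the identity. *)
Lemma derive_transitionK c c' p v : atlas S c -> atlas S c' ->
  chart_dom c p -> chart_dom c' p ->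
  'D_('D_v (c' \o chart_inv c) (c p)) (c \o chart_inv c') (c' p) = v.
Proof.
move=> Sc Sc' cp c'p.
have d1 := transition_differentiable Sc Sc' cp c'p.
have d2 := transition_differentiable Sc' Sc c'p cp.
have e1 : is_derive (c p) v (c' \o chart_inv c) ('D_v (c' \o chart_inv c) (c p)).
  exact/derivableP/diff_derivable.
have fp : (c' \o chart_inv c) (c p) = c' p by rewrite /= chart_mapK.
have d2' : differentiable (c \o chart_inv c') ((c' \o chart_inv c) (c p)) by rewrite fp.
have e2 := is_derive_comp e1 d2'.
have nearid : \forall x \near c p, x = ((c \o chart_inv c') \o (c' \o chart_inv c)) x.
  apply: filterS (near_overlap cp c'p) => x [cx c'x] /=.
  by rewrite (chart_mapK (c := c'))// chart_invK.
have e3 := near_eq_derive v nearid.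
move: e3; rewrite (derive_id (c p) v) (@derive_val _ _ _ _ _ _ _ e2) fp.
by move=> <-.
Qed.

Lemma tangent_of_coordK c x y : atlas S c -> chart_img c x ->
  coord_of_tangent S c (tangent_of_coord S c x y) = y.
Proof.
move=> Sc [p cp <-]; rewrite /coord_of_tangent /tangent_of_coord /tangent.
rewrite (chart_mapK cp); apply: derive_transitionK => //.
- exact: chart_at_atlas.
- exact: chart_at_dom.
Qed.

Lemma coord_of_tangentK c x (v : tangent R n (chart_inv c x)) :
  atlas S c -> chart_img c x ->
  tangent_of_coord S c x (coord_of_tangent S c v) = v.
Proof.
move=> Sc [p cp xE]; move: v; rewrite -xE /coord_of_tangent /tangent_of_coord /tangent.
rewrite (chart_mapK cp) => v; apply: derive_transitionK => //.
- exact: chart_at_atlas.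
- exact: chart_at_dom.
Qed.

Lemma tangent_of_coord_linear c x : atlas S c -> chart_img c x ->
  linear (tangent_of_coord S c x : E -> E).
Proof.
move=> Sc [p cp <-] a u v; rewrite /tangent_of_coord; apply: derive_linear.
rewrite chart_mapK//; apply: transition_differentiable => //.
- exact: chart_at_atlas.
- exact: chart_at_dom.
Qed.

Lemma coord_of_tangent_linear c p : atlas S c -> chart_dom c p ->
  linear (coord_of_tangent S c (p := p) : E -> E).
Proof.
move=> Sc cp a u v; rewrite /coord_of_tangent; apply: derive_linear.
apply: transition_differentiable => //.
- exact: chart_at_atlas.
- exact: chart_at_dom.
Qed.

(** A tangent vector at p is stored by its components in the chart chosen at p. *)
Lemma coord_of_tangent_self p (v : tangent R n p) :
  coord_of_tangent S (chart_at S p) v = v.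
Proof.
rewrite /coord_of_tangent (@near_eq_derive _ _ _ _ id) ?derive_id//.
apply: filterS (near_overlap (chart_at_dom S p) (chart_at_dom S p)) => x [cx _].
exact: chart_invK.
Qed.

End Charts.

(** * Smoothness of left invariant fields *)

Section LieCharts.
Context {R : realType} {n : nat} {G : groupTopologicalType}.
Local Notation E := 'rV[R]_n.+1.
Variable L : lie_structure R n G.
Implicit Types (c : chart R n G) (p : G).

(** The multiplication is known to be smooth only on this set, and differentiability
    is deduced from smoothness on open sets. *)
Lemma open_mul_domain c1 c2 c3 :
  open [set z : E * E | [/\ chart_img c1 z.1, chart_img c2 z.2
          & chart_dom c3 (chart_inv c1 z.1 * chart_inv c2 z.2)%g]].
Proof.
rewrite openE => -[x y] /= [cx cy cxy].
have fst_cvg : (fun z : E * E => z.1) @ nbhs (x, y) --> x by exact: cvg_fst.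
have snd_cvg : (fun z : E * E => z.2) @ nbhs (x, y) --> y by exact: cvg_snd.
have mul_cvg : (fun z : E * E => (chart_inv c1 z.1 * chart_inv c2 z.2)%g)
    @ nbhs (x, y) --> (chart_inv c1 x * chart_inv c2 y)%g.
  have pair_cvg : (fun z : E * E => (chart_inv c1 z.1, chart_inv c2 z.2))
      @ nbhs (x, y) --> (chart_inv c1 x, chart_inv c2 y).
    apply: cvg_pair.
      by apply: (cvg_comp _ _ fst_cvg); exact: chart_inv_cont.
    by apply: (cvg_comp _ _ snd_cvg); exact: chart_inv_cont.
  exact: (cvg_comp _ _ pair_cvg (@lie_mul_cont _ _ _ L _)).
have Hx : \forall z \near (x, y), chart_img c1 z.1.
  apply: fst_cvg; apply: open_nbhs_nbhs; split=> //; exact: chart_img_open.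
have Hy : \forall z \near (x, y), chart_img c2 z.2.
  apply: snd_cvg; apply: open_nbhs_nbhs; split=> //; exact: chart_img_open.
have Hxy : \forall z \near (x, y), chart_dom c3 (chart_inv c1 z.1 * chart_inv c2 z.2)%g.
  by apply: mul_cvg; apply: open_nbhs_nbhs; split=> //; exact: chart_dom_open.
rewrite /interior/=; near=> z; split; near: z => //.
Unshelve. all: by end_near. Qed.

Local Notation c0 := (chart_at L 1%g).
Local Notation x0 := (chart_at L 1%g 1%g).

Lemma identity_chart_img : chart_img c0 x0.
Proof. by apply: chart_img_map; exact: chart_at_dom. Qed.

Lemma identity_chart_inv : chart_inv c0 x0 = 1%g.
Proof. by rewrite chart_mapK//; exact: chart_at_dom. Qed.

Lemma left_translation_differentiable c p : atlas L c -> chart_dom c p ->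
  differentiable (fun z => c (p * chart_inv c0 z)%g) x0.
Proof.
move=> Lc cp; pose cp' := chart_at L p.
have Lcp : atlas L cp' by exact: chart_at_atlas.
have L0 : atlas L c0 by exact: chart_at_atlas.
have := Ck_slice_r (cp' p) (@lie_mul_smooth _ _ _ L cp' c0 c Lcp L0 Lc 1%N).
have -> : (fun y => c (chart_inv cp' (cp' p, y).1 * chart_inv c0 (cp' p, y).2)%g)
    = (fun z => c (p * chart_inv c0 z)%g).
  by apply: funext => z /=; rewrite chart_mapK//; exact: chart_at_dom.
move=> /Ck1_differentiable_mx; apply.
  exact: (open_slice_r _ (@open_mul_domain cp' c0 c)).
split=> /=; first exact/chart_img_map/chart_at_dom.
  exact: identity_chart_img.
by rewrite identity_chart_inv chart_mapK ?mulg1//; exact: chart_at_dom.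
Qed.

(** A left invariant field is the derivative of right factors: X(p) is the velocity
    at 1 of z -> p z.  In a chart this exhibits X as a partial derivative of the
    multiplication. *)
Lemma left_invariant_coord c (X : vector_field R n G) x :
  left_invariant_field L X -> atlas L c -> chart_img c x ->
  vf_coord L c X x =
  'D_(0, X 1%g) (fun z : E * E => c (chart_inv c z.1 * chart_inv c0 z.2)%g) (x, x0).
Proof.
move=> LX Lc cx; rewrite derive_pair_r /= /vf_coord; set p := chart_inv c x.
have cp : chart_dom c p by exact: chart_inv_dom.
have XpE : X p = 'D_(X 1%g) (fun z => chart_at L p (p * chart_inv c0 z)%g) x0.
  by have := LX p 1%g; rewrite /left_translation mulg1 => <-; rewrite /tangent_map mulg1.
have d1 := left_translation_differentiable (chart_at_atlas L p) (chart_at_dom L p).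
have e1 : is_derive x0 (X 1%g) (fun z => chart_at L p (p * chart_inv c0 z)%g) (X p).
  by rewrite XpE; exact/derivableP/diff_derivable.
have d2 : differentiable (c \o chart_inv (chart_at L p))
    (chart_at L p (p * chart_inv c0 x0)%g).
  rewrite identity_chart_inv mulg1; apply: transition_differentiable.
  - exact: chart_at_atlas.
  - exact: Lc.
  - exact: chart_at_dom.
  - exact: cp.
have e2 := is_derive_comp e1 d2.
have nearE : \forall z \near x0, c (p * chart_inv c0 z)%g =
    ((c \o chart_inv (chart_at L p)) \o
     (fun z => chart_at L p (p * chart_inv c0 z)%g)) z.
  have pz : (fun z => p * chart_inv c0 z)%g @ nbhs x0 --> (p * 1)%g.
    apply: (cvg_comp (fun z : E => (p, chart_inv c0 z)) (fun z : G * G => (z.1 * z.2)%g)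
      _ (@lie_mul_cont _ _ _ L (p, 1%g))).
    apply: cvg_pair; first exact: cvg_cst.
    have := chart_inv_cont identity_chart_img.
    by rewrite /prop_for /continuous_at identity_chart_inv.
  have : \forall z \near x0, chart_dom (chart_at L p) (p * chart_inv c0 z)%g.
    apply: pz; rewrite mulg1; apply: open_nbhs_nbhs; split.
      exact: chart_dom_open.
    exact: chart_at_dom.
  by apply: filterS => z pz_dom /=; rewrite chart_mapK.
rewrite (near_eq_derive _ nearE) (@derive_val _ _ _ _ _ _ _ e2) identity_chart_inv mulg1.
by [].
Qed.

(** A partial derivative of a smooth map, restricted to a slice. *)
Lemma left_invariant_smooth c (X : vector_field R n G) :
  left_invariant_field L X -> atlas L c ->
  smooth_on (chart_img c) (vf_coord L c X).
Proof.
move=> LX Lc k; have L0 : atlas L c0 by exact: chart_at_atlas.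
have [_ /(_ (0, X 1%g))[_ Cf]] := @lie_mul_smooth _ _ _ L c c0 c Lc L0 Lc k.+1.
have C1 := Ck_slice_l x0 Cf.
have sub : chart_img c `<=` [set x | [/\ chart_img c x, chart_img c0 x0
    & chart_dom c (chart_inv c x * chart_inv c0 x0)%g]].
  move=> x cx; split=> //; first exact: identity_chart_img.
  by rewrite identity_chart_inv mulg1; exact: chart_inv_dom.
have C2 := Ck_sub sub C1.
apply: Ck_ext C2; first exact: chart_img_open.
by move=> x cx; rewrite -left_invariant_coord.
Qed.

End LieCharts.

(** * Left invariant orthonormal frames *)

Section Orthonormal.
Context {R : realType} {n : nat}.
Local Notation E := 'rV[R]_n.+1.
Variables (a : E -> E -> R) (e : 'I_n.+1 -> E).
Hypothesis aC : forall u v, a u v = a v u.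
Hypothesis a_scalar : forall u, scalar (a u).
Hypothesis e_orth : forall i j, a (e i) (e j) = (i == j)%:R.

Lemma form_suml (I : finType) (w : I -> R) (f : I -> E) v :
  a (\sum_i w i *: f i) v = \sum_i w i * a (f i) v.
Proof.
have aZ k u : a (k *: u) v = k * a u v by rewrite aC scalar_scale// aC.
have aD u u' : a (u + u') v = a u v + a u' v by rewrite aC scalar_add// !(aC v).
have a0 : a 0 v = 0 by rewrite -(scale0r (0 : E)) aZ mul0r.
by rewrite (big_morph (a^~ v) aD a0); apply: eq_bigr => i _; rewrite aZ.
Qed.

(** The n+1 vectors are independent because pairing with them recovers the
    coefficients, hence they form a basis by dimension. *)
Lemma orthonormal_expand v : v = \sum_i a v (e i) *: e i.
Proof.
pose M := \matrix_i e i.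
have combE (w : E) : w *m M = \sum_i w 0 i *: e i.
  by rewrite mulmx_sum_row; apply: eq_bigr => i _; rewrite rowK.
have coef (w : E) i : a (w *m M) (e i) = w 0 i.
  rewrite combE form_suml (bigD1 i)//= e_orth eqxx mulr1 big1 ?addr0//.
  by move=> j /negPf ji; rewrite e_orth ji mulr0.
have Mu : M \in unitmx.
  rewrite -row_free_unit -kermx_eq0; apply/rowV0P => w /sub_kermxP wM.
  apply/rowP => i; rewrite -coef wM mxE aC.
  by rewrite -(scale0r (0 : E)) scalar_scale// mul0r.
have vE : v = v *m invmx M *m M by rewrite mulmxKV.
rewrite [LHS]vE combE; apply: eq_bigr => i _.
by rewrite [in RHS]vE coef.
Qed.

Lemma orthonormal_form u v : a u v = \sum_i a u (e i) * a v (e i).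
Proof.
rewrite {1}[u]orthonormal_expand form_suml.
by apply: eq_bigr => i _; rewrite (aC (e i)).
Qed.

End Orthonormal.

(** The bookkeeping behind [structure_equation]: exchanging the two sums of the
    second term skew-symmetrizes the coefficients. *)
Lemma skew_double_sum (R : realType) n (D : 'I_n.+1 -> 'I_n.+1 -> 'rV[R]_n.+1)
    (z u : 'rV[R]_n.+1) (A : 'M[R]_n.+1) :
  - (\sum_i \sum_j (z 0 i * u 0 j) *: D i j) *m A -
  - (\sum_i \sum_j (u 0 i * z 0 j) *: D i j) *m A =
  \sum_i \sum_j (z 0 i * u 0 j) *: ((D j i - D i j) *m A).
Proof.
rewrite -mulmxBl opprK addrC [X in X - _]exchange_big/= -sumrB mulmx_suml.
apply: eq_bigr => i _; rewrite -sumrB mulmx_suml; apply: eq_bigr => j _.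
by rewrite [u 0 j * _]mulrC -scalerBr scalemxAl.
Qed.

Section Frame.
Context {R : realType} {n : nat} {G : groupTopologicalType}.
Local Notation E := 'rV[R]_n.+1.
Variable L : lie_structure R n G.
Variable atilde : forall p : G, tangent R n p -> tangent R n p -> R.
Hypothesis atilde_riemannian : riemannian_metric L atilde.
Hypothesis atilde_left_invariant : left_invariant_metric L atilde.
Variable e : 'I_n.+1 -> vector_field R n G.
Hypothesis e_orthonormal : orthonormal_frame L atilde e.
Variable X : vector_field R n G.
Hypothesis X_left_invariant : left_invariant_field L X.

Local Notation c0 := (chart_at L 1%g).
Local Notation x0 := (chart_at L 1%g 1%g).

(** By left invariance the components at the identity are those at every point. *)
Definition field_coef : E := \row_i atilde (X 1%g) (e i 1%g).

Let aC p (u v : E) : @atilde p u v = @atilde p v u.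
Proof. by case: atilde_riemannian => + _ _ _; apply. Qed.

Let a_scalar p (u : E) : scalar (@atilde p u : E -> R).
Proof. by case: atilde_riemannian => _ + _ _; apply. Qed.

Let e_left i : left_invariant_field L (e i).
Proof. by case: e_orthonormal. Qed.

Let e_orth p i j : @atilde p (e i p) (e j p) = (i == j)%:R.
Proof. by case: e_orthonormal. Qed.

(** Left translations preserve the metric and both fields. *)
Lemma field_coefE p i : @atilde p (X p) (e i p) = field_coef 0 i.
Proof.
have := atilde_left_invariant p (X 1%g) (e i 1%g).
by rewrite X_left_invariant (e_left i p 1%g) /left_translation mulg1 mxE.
Qed.

(** Row m holds the frame components of the m-th coordinate vector, so that
    y *m coframe x are the frame components of the vector with coordinates y. *)
Definition coframe (x : E) : 'M[R]_n.+1 := \matrix_(m, i)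
  @atilde (chart_inv c0 x) (tangent_of_coord L c0 x (delta_mx 0 m)) (e i (chart_inv c0 x)).

Definition frame (x : E) : 'M[R]_n.+1 := \matrix_i vf_coord L c0 (e i) x.

Let L0 : atlas L c0. Proof. exact: chart_at_atlas. Qed.

Lemma coframeE x (y : E) i : chart_img c0 x ->
  (y *m coframe x) 0 i =
  @atilde (chart_inv c0 x) (tangent_of_coord L c0 x y) (e i (chart_inv c0 x)).
Proof.
move=> cx; pose f (y : E) : R :=
  @atilde (chart_inv c0 x) (tangent_of_coord L c0 x y) (e i (chart_inv c0 x)).
have fL : scalar f.
  move=> k u v; rewrite /f (tangent_of_coord_linear L0 cx) aC a_scalar.
  by rewrite !(aC _ (e i _)).
rewrite -/(f y) (scalar_sum_delta y fL) mxE.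
by apply: eq_bigr => m _; rewrite mxE.
Qed.

Lemma coframe_frame x : chart_img c0 x -> coframe x *m frame x = 1%:M.
Proof.
move=> cx; apply/row_matrixP => m; rewrite row_mul row1 rowE.
rewrite mulmx_sum_row.
have cp := chart_inv_dom cx.
transitivity (coord_of_tangent L c0 (tangent_of_coord L c0 x (delta_mx 0 m))); last first.
  exact: tangent_of_coordK.
rewrite [tangent_of_coord _ _ _ _ in RHS](orthonormal_expand (@aC _) (@a_scalar _)
  (@e_orth (chart_inv c0 x))).
pose C (v : E) : E := coord_of_tangent L c0 (v : tangent R n (chart_inv c0 x)).
have CL : linear C by exact: coord_of_tangent_linear.
rewrite -[RHS]/(C _).
pose CM := GRing.isLinear.Build _ _ _ _ _ CL.
pose CC : {linear E -> E} := HB.pack C CM.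
rewrite -[C]/(CC : E -> E) linear_sum; apply: eq_bigr => i _.
by rewrite linearZ coframeE// rowK.
Qed.

Let oU : open (chart_img c0). Proof. exact: chart_img_open. Qed.

(** Expressed through the coordinates of the metric and of the frame, both smooth. *)
Lemma coframe_smooth k m i : Ck k (chart_img c0) (fun x => coframe x m i : R).
Proof.
have eC := left_invariant_smooth (e_left i) L0 k.
case: atilde_riemannian => _ _ _ /(_ c0 L0 m) aS.
pose h x := \sum_(l < n.+1) vf_coord L c0 (e i) x 0 l *
  @atilde (chart_inv c0 x) (tangent_of_coord L c0 x (basis_vec m))
    (tangent_of_coord L c0 x (basis_vec l)).
have hE x : chart_img c0 x -> h x = coframe x m i.
  move=> cx; rewrite mxE -[e i (chart_inv c0 x)](@coord_of_tangentK _ _ _ L c0 x)//.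
  pose f (y : E) : R := @atilde (chart_inv c0 x) (tangent_of_coord L c0 x (basis_vec m))
    (tangent_of_coord L c0 x y).
  have fL : scalar f.
    by move=> r u v; rewrite /f (tangent_of_coord_linear L0 cx) a_scalar.
  by rewrite -[RHS]/(f _) (scalar_sum_delta _ fL).
apply: (Ck_ext oU hE).
apply: Ck_sum => // l; apply: Ck_mul => //; last exact: aS.
exact: Ck_entry.
Qed.

Local Notation N := (ab_norm field_coef).

Lemma metric_frame p (v : tangent R n p) :
  atilde v v = dot (\row_i @atilde p v (e i p)) (\row_i @atilde p v (e i p)).
Proof.
rewrite (orthonormal_form (@aC p) (@a_scalar p) (@e_orth p)) /dot.
by apply: eq_bigr => i _; rewrite mxE.
Qed.

Lemma metric_norm_frame p (v : tangent R n p) :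
  metric_norm atilde v = enorm (\row_i @atilde p v (e i p)).
Proof. by rewrite /metric_norm /enorm metric_frame. Qed.

Lemma form_frame p (v : tangent R n p) :
  @atilde p v (X p) = dot field_coef (\row_i @atilde p v (e i p)).
Proof.
rewrite (orthonormal_form (@aC p) (@a_scalar p) (@e_orth p)) /dot.
by apply: eq_bigr => i _; rewrite field_coefE mxE mulrC.
Qed.

Definition bracket_coef (i j : 'I_n.+1) : E :=
  vf_bracket L (e i) (e j) 1%g *m coframe x0.

Definition bracket (z u : E) : E :=
  \sum_i \sum_j (z 0 i * u 0 j) *: bracket_coef i j.

Lemma bracket_coef_skew i j : bracket_coef i j = - bracket_coef j i.
Proof. by rewrite /bracket_coef /vf_bracket -mulNmx opprB. Qed.

Lemma bracket_linearr z : linear (bracket z).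
Proof.
move=> k u v; rewrite /bracket scaler_sumr -big_split/=; apply: eq_bigr => i _.
rewrite scaler_sumr -big_split/=; apply: eq_bigr => j _.
by rewrite !mxE scalerA -scalerDl; congr (_ *: _); ring.
Qed.

Lemma bracket_skew u v : bracket u v = - bracket v u.
Proof.
rewrite /bracket exchange_big/= -sumrN; apply: eq_bigr => i _.
rewrite -sumrN; apply: eq_bigr => j _.
by rewrite bracket_coef_skew scalerN mulrC.
Qed.

Lemma bracket_linearl z : linear (bracket^~ z).
Proof.
move=> k u v; rewrite bracket_skew bracket_linearr.
by rewrite (bracket_skew u) (bracket_skew v) opprD scalerN.
Qed.

Definition dcoframe (v : E) : 'M[R]_n.+1 :=
  \matrix_(m, i) 'D_v (fun x => coframe x m i : R) x0.

Let x0U : chart_img c0 x0. Proof. exact: identity_chart_img. Qed.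

Let coframe_diff m i : differentiable (fun x => coframe x m i : R) x0.
Proof.
exact: (Ck1_differentiable oU (coframe_smooth 1 m i)).
Qed.

Lemma is_derive_coframe v : is_derive x0 v coframe (dcoframe v).
Proof.
apply/is_derive_mxP => m i; rewrite mxE.
by apply/derivableP/diff_derivable; exact: coframe_diff.
Qed.

Lemma dcoframe_linear : linear dcoframe.
Proof.
move=> k u v; apply/matrixP => m i; rewrite !mxE.
exact: (derive_linear _ _ _ (coframe_diff m i)).
Qed.

Lemma frame_at_identity i : vf_coord L c0 (e i) x0 = e i 1%g.
Proof. by rewrite /vf_coord identity_chart_inv coord_of_tangent_self. Qed.

Lemma frame_coframe0 : frame x0 *m coframe x0 = 1%:M.
Proof. by apply: mulmx1C; exact: coframe_frame. Qed.

Lemma frame_vec_coframe i : e i 1%g *m coframe x0 = delta_mx 0 i.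
Proof.
by rewrite -frame_at_identity -[vf_coord _ _ _ _](rowK (fun i => vf_coord L c0 (e i) x0))
  -/(frame x0) -row_mul frame_coframe0 row1.
Qed.

(** The Maurer-Cartan equation at the identity.
    Differentiating coframe * frame = 1 expresses the derivative of the coframe
    through that of the frame, whose skew part is the bracket. *)
Lemma structure_equation (u z : E) :
  z *m frame x0 *m dcoframe (u *m frame x0) -
  u *m frame x0 *m dcoframe (z *m frame x0) = bracket z u.
Proof.
pose b i : E -> E := vf_coord L c0 (e i).
pose dfr (v : E) := \matrix_i ('D_v (b i) x0 : E).
have b_diff i : differentiable (b i) x0.
  exact: (Ck1_differentiable_mx oU (left_invariant_smooth (e_left i) L0 1)).
have is_dfr v : is_derive x0 v frame (dfr v).
  apply/is_derive_mxP => i j; rewrite mxE.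
  have -> : (fun x => frame x i j) = (fun x => b i x 0 j).
    by apply: funext => x; rewrite mxE.
  have H : is_derive x0 v (b i) ('D_v (b i) x0) by exact/derivableP/diff_derivable.
  by move/is_derive_mxP: H; apply.
have dA v : dcoframe v = - (coframe x0 *m dfr v *m coframe x0).
  have H := is_derive_mulmx (is_derive_coframe v) (is_dfr v).
  have H0 : dcoframe v *m frame x0 + coframe x0 *m dfr v = 0.
    rewrite -(@derive_val _ _ _ _ _ _ _ H) -(derive_cst (1%:M : 'M[R]_n.+1) x0 v).
    apply: near_eq_derive; apply: near_open_eq x0U; first exact: oU.
    by move=> x; exact: coframe_frame.
  move/eqP: H0; rewrite addr_eq0 => /eqP /(congr1 (fun D => D *m coframe x0)).
  by rewrite -mulmxA frame_coframe0 mulmx1 mulNmx.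
have half (w v : E) : w *m frame x0 *m dcoframe v =
    - (\sum_i w 0 i *: 'D_v (b i) x0) *m coframe x0.
  rewrite dA mulmxN !mulmxA -[w *m _ *m _]mulmxA frame_coframe0 mulmx1 mulNmx.
  by congr (- (_ *m _)); rewrite mulmx_sum_row; apply: eq_bigr => i _; rewrite rowK.
have expand (w v : E) : \sum_i w 0 i *: 'D_(v *m frame x0) (b i) x0 =
    \sum_i \sum_j (w 0 i * v 0 j) *: 'D_(e j 1%g) (b i) x0.
  apply: eq_bigr => i _.
  pose D : {linear E -> E} := 'd (b i) x0.
  have DE y : 'D_y (b i) x0 = D y by rewrite deriveE.
  rewrite DE mulmx_sum_row linear_sum scaler_sumr; apply: eq_bigr => j _.
  by rewrite linearZ scalerA -DE rowK frame_at_identity.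
pose D i j : E := 'D_(e j 1%g) (b i) x0.
have bracketE i j : bracket_coef i j = (D j i - D i j) *m coframe x0.
  by rewrite /bracket_coef /vf_bracket !frame_at_identity.
have half2 (w v : E) : w *m frame x0 *m dcoframe (v *m frame x0) =
    - (\sum_i \sum_j (w 0 i * v 0 j) *: D i j) *m coframe x0.
  exact: (etrans (half w (v *m frame x0)) (congr1 (fun P => - P *m coframe x0) (expand w v))).
apply: (etrans (congr2 (fun P Q => P - Q) (half2 z u) (half2 u z))).
have -> : bracket z u =
    \sum_i \sum_j (z 0 i * u 0 j) *: ((D j i - D i j) *m coframe x0).
  by apply: eq_bigr => i _; apply: eq_bigr => j _; rewrite bracketE.
exact: (skew_double_sum D z u (coframe x0)).
Qed.

End Frame.

Section AlphaBetaLie.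
Context {R : realType} {n : nat} {G : groupTopologicalType}.
Local Notation E := 'rV[R]_n.+1.
Variable L : lie_structure R n G.
Variable atilde : forall p : G, tangent R n p -> tangent R n p -> R.
Hypothesis atilde_riemannian : riemannian_metric L atilde.
Hypothesis atilde_left_invariant : left_invariant_metric L atilde.
Variable e : 'I_n.+1 -> vector_field R n G.
Hypothesis e_orthonormal : orthonormal_frame L atilde e.
Variable X : vector_field R n G.
Hypothesis X_left_invariant : left_invariant_field L X.
Local Notation c0 := (chart_at L 1%g).
Local Notation x0 := (chart_at L 1%g 1%g).
Local Notation xi := (field_coef atilde e X).

Lemma frame_comb_coef p (w : E) i :
  @atilde p (\sum_j w 0 j *: e j p) (e i p) = w 0 i.
Proof.
case: atilde_riemannian => aC aS _ _; case: e_orthonormal => _ e_orth.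
rewrite (form_suml (aC p) (aS p)) (bigD1 i)//= e_orth eqxx mulr1.
by rewrite big1 ?addr0// => j /negPf ji; rewrite e_orth ji mulr0.
Qed.

(** The value |x| is taken at x / |x|.  This places the range of s inside the domain
    of phi. *)
Lemma one_form_norm_ge p :
  enorm xi <= one_form_norm atilde (fun p y => atilde y (X p)) p.
Proof.
pose coef (v : tangent R n p) : E := \row_i atilde v (e i p).
have bv (v : tangent R n p) : atilde v (X p) = dot xi (coef v).
  exact: (form_frame atilde_riemannian atilde_left_invariant e_orthonormal).
have nv (v : tangent R n p) : metric_norm atilde v = enorm (coef v).
  exact: (metric_norm_frame atilde_riemannian e_orthonormal).
pose D := [set v : tangent R n p | metric_norm atilde v <= 1].
have ub (v : tangent R n p) : D v -> `|atilde v (X p)| <= enorm xi.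
  rewrite /D/= bv nv => v1; apply: (le_trans (norm_dot_le _ _)).
  by rewrite ler_piMr ?enorm_ge0.
rewrite /one_form_norm -/D; apply: sup_ubound.
  by exists (enorm xi) => _ [v Dv <-]; exact: ub.
pose w := (enorm xi)^-1 *: xi.
have xiw : dot xi w = enorm xi.
  rewrite /w dotZr -sqr_enorm; have [->|xi0] := eqVneq (enorm xi) 0.
    by rewrite expr0n mulr0.
  by rewrite expr2 mulKf.
have coefw : coef (\sum_j w 0 j *: e j p) = w.
  by apply/rowP => i; rewrite mxE frame_comb_coef.
exists (\sum_j w 0 j *: e j p).
  rewrite /D/= nv coefw -(@ler_pXn2r _ 2) ?nnegrE ?enorm_ge0// expr1n sqr_enorm.
  rewrite {1}/w dotZl xiw; have [->|xi0] := eqVneq (enorm xi) 0.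
    by rewrite mulr0.
  by rewrite mulVf.
by rewrite bv coefw xiw ger0_norm// enorm_ge0.
Qed.

Variable F : forall p : G, tangent R n p -> R.
Hypothesis F_alpha_beta : alpha_beta_metric L atilde (fun p y => atilde y (X p)) F.

(** The regularity condition is used twice: with b = |s| it gives kappa > 0, and
    with the actual norm of beta it gives Delta > 0. *)
Lemma alpha_beta_frame : exists phi phi1 phi2 : R -> R,
  [/\ forall s : R, `|s| <= enorm xi ->
        [/\ is_derive s 1 phi (phi1 s), is_derive s 1 phi1 (phi2 s), 0 < phi s,
            0 < kappa phi phi1 s
          & 0 < kappa phi phi1 s + (enorm xi ^+ 2 - s ^+ 2) * phi2 s]
    & forall p (v : tangent R n p),
        F v = ab_norm xi phi (\row_i atilde v (e i p))].
Proof.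
case: F_alpha_beta => _ _ _ [b0 [phi [phi_gt0 phiC phi_reg norm_lt FE]]].
exists phi, (derive1 phi), (derive1n 2 phi); split=> [s sxi|p v]; last first.
  rewrite FE (metric_norm_frame atilde_riemannian e_orthonormal).
  by rewrite (form_frame atilde_riemannian atilde_left_invariant e_orthonormal).
have xi_lt : ((enorm xi)%:E < b0)%E.
  by apply: le_lt_trans (norm_lt 1%g); rewrite lee_fin; exact: one_form_norm_ge.
have sb0 : (`|s|%:E < b0)%E by apply: le_lt_trans xi_lt; rewrite lee_fin.
have [_ /(_ 1)[d1 [_ /(_ 1)[d2 _]]]] := phiC 2%N.
have E1 : derive1 phi = (fun r => 'D_1 phi r).
  by apply: funext => r; rewrite derive1E.
split.
- by rewrite derive1E; exact/derivableP/d1.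
- rewrite (derive1nS _ 1) derive1n1 derive1E E1; exact/derivableP/d2.
- exact: phi_gt0.
- by have := phi_reg s `|s| (lexx _) sb0; rewrite real_normK ?num_real// subrr mul0r addr0.
- exact: phi_reg.
Qed.

Hypothesis F_douglas : douglas_type L F.

Lemma douglas_frame (phi phi1 phi2 : R -> R) :
  (forall s : R, `|s| <= enorm xi ->
        [/\ is_derive s 1 phi (phi1 s), is_derive s 1 phi1 (phi2 s), 0 < phi s,
            0 < kappa phi phi1 s
          & 0 < kappa phi phi1 s + (enorm xi ^+ 2 - s ^+ 2) * phi2 s]) ->
  (forall p (v : tangent R n p), F v = ab_norm xi phi (\row_i atilde v (e i p))) ->
  exists Q : E -> E -> E,
  [/\ forall u, linear (Q u), forall u, linear (Q^~ u)
    & forall u z, u != 0 ->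
        ab_hess xi phi phi1 phi2 u z (Q u u) = ab_diff xi phi phi1 u (bracket L atilde e z u)].
Proof.
move=> phiP FE; have L0 : atlas L c0 by exact: chart_at_atlas.
case: F_alpha_beta => _ _ [_ _ _ g_pos] _.
have [Gamma [P [_ FD]]] := F_douglas L0.
have Ux0 := identity_chart_img L.
have near_expr : \forall x \near x0, forall y : E,
    coord_expr L F c0 x y = ab_norm xi phi (y *m coframe L atilde e x).
  have : \forall x \near x0, chart_img c0 x.
    by apply: open_nbhs_nbhs; split=> //; exact: chart_img_open.
  apply: filterS => x cx y; rewrite /coord_expr FE; congr ab_norm.
  by apply/rowP => i; rewrite mxE (coframeE atilde_riemannian).
apply: (@douglas_projective R n G L F c0 x0 xi phi phi1 phi2 (coframe L atilde e)
  (dcoframe L atilde e) (frame L e x0) _ _ _ _ near_expr _ _ _ (bracket L atilde e) _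
  (fun i j k => Gamma i j k x0) (P x0)).
- by move=> s /phiP[].
- by move=> s /phiP[].
- exact: (is_derive_coframe atilde_riemannian e_orthonormal).
- exact: (coframe_frame atilde_riemannian e_orthonormal Ux0).
- exact: (dcoframe_linear atilde_riemannian e_orthonormal).
- by move=> s /phiP[].
- by move=> y y0; exact: g_pos.
- exact: (structure_equation atilde_riemannian e_orthonormal).
- by move=> y i y0; rewrite FD.
Qed.

End AlphaBetaLie.

(** * Norms satisfying the projective equation *)

Section DouglasAlgebra.
Context {R : realType} {n : nat}.
Local Notation E := 'rV[R]_n.
Variables (X : E) (phi phi1 phi2 : R -> R) (Q br : E -> E -> E).
Implicit Types u v w z r : E.
Local Notation kap := (kappa phi phi1).
Local Notation b := (enorm X).
Hypothesis Ql : forall u, linear (Q^~ u).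
Hypothesis Qr : forall u, linear (Q u).
Hypothesis brl : forall u, linear (br^~ u).
Hypothesis brr : forall u, linear (br u).
Hypothesis douglas : forall u z, u != 0 ->
  ab_hess X phi phi1 phi2 u z (Q u u) = ab_diff X phi phi1 u (br z u).
Hypothesis X0 : X != 0.

Let b_gt0 : 0 < b. Proof. exact: enorm_gt0. Qed.

(** For the Euclidean norm the projective equation holds with
    <z, Q(u)> = <u, [z, u]>; this is the distance from that solution. *)
Definition deviation z u v : R := dot z (Q u v) - dot u (br z v).

Lemma deviation_expand z (u v w : E) (t p q : R) :
  let x := t *: u + p *: v + q *: w in
  deviation z x x = t ^+ 2 * deviation z u u + p ^+ 2 * deviation z v v + q ^+ 2 * deviation z w w
    + t * p * (deviation z u v + deviation z v u) + t * q * (deviation z u w + deviation z w u)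
    + p * q * (deviation z v w + deviation z w v).
Proof.
have Dr y : scalar (deviation z y).
  by move=> k y1 y2; rewrite /deviation Qr brr !dotDr !dotZr; ring.
have Dl y : scalar (deviation z ^~ y).
  by move=> k y1 y2; rewrite /deviation Ql !dotDr !dotZr !dotDl !dotZl; ring.
have Er y y1 y2 : deviation z y (y1 + y2) = deviation z y y1 + deviation z y y2.
  exact: (scalar_add _ _ (Dr y)).
have Sr y k y1 : deviation z y (k *: y1) = k * deviation z y y1.
  exact: (scalar_scale _ _ (Dr y)).
have El y y1 y2 : deviation z (y1 + y2) y = deviation z y1 y + deviation z y2 y.
  exact: (scalar_add _ _ (Dl y)).
have Sl y k y1 : deviation z (k *: y1) y = k * deviation z y1 y.
  exact: (scalar_scale _ _ (Dl y)).
by rewrite /= !(Er, El, Sr, Sl); ring.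
Qed.

Lemma deviation_scalar u v : scalar (fun z => deviation z u v).
Proof. by move=> k z z'; rewrite /deviation brl dotDl dotZl dotDr dotZr; ring. Qed.

(** Orthogonality of z to u and to x makes ds(z) vanish, and with it the term
    in phi''. *)
Lemma douglas_perp u z : u != 0 -> dot X z = 0 -> dot u z = 0 ->
  kap (slope X u) * deviation z u u = phi1 (slope X u) * enorm u * dot X (br z u).
Proof.
move=> u0 Xz uz; have n0 : enorm u != 0 by rewrite gt_eqF// enorm_gt0.
have := douglas z u0; rewrite /ab_hess /ab_diff /dslope Xz uz !(mul0r, mulr0, subr0, addr0).
move=> /(congr1 (fun y => enorm u * y)); rewrite /deviation.
move: (kap _) (phi1 _) => k p1.
move: (dot z _) (dot u _) (dot X _) (enorm u) n0 => d1 d2 d3 r r0 H.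
have E1 : r * (k * (d1 / r)) = k * d1 by field.
have E2 : r * (k * (d2 / r) + p1 * d3) = k * d2 + p1 * r * d3 by field.
by rewrite E1 E2 in H; rewrite mulrBr H; ring.
Qed.

Lemma enorm_line (y : E) t : dot X y = 0 ->
  enorm (t *: X + y) ^+ 2 = b ^+ 2 * t ^+ 2 + enorm y ^+ 2.
Proof.
move=> Xy; rewrite !sqr_enorm dotDl !dotDr !dotZl !dotZr Xy (dotC y) Xy.
by ring.
Qed.

Lemma dotX_line (y : E) t : dot X y = 0 -> dot X (t *: X + y) = b ^+ 2 * t.
Proof. by move=> Xy; rewrite dotDr dotZr Xy addr0 sqr_enorm mulrC. Qed.

(** Along the line t x + y the slope t b^2 / sqrt(b^2 t^2 + |y|^2) sweeps the whole
    open interval, so an identity along one such line is an identity for phi. *)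
Lemma slope_surj (y : E) (s : R) : dot X y = 0 -> y != 0 -> `|s| < b ->
  exists t, slope X (t *: X + y) = s.
Proof.
move=> Xy y0 sb.
have y_gt0 : 0 < enorm y by exact: enorm_gt0.
have bs : 0 < b ^+ 2 - s ^+ 2.
  by rewrite subr_gt0 -(real_normK (num_real s)) ltr_pXn2r ?nnegrE// ltW.
pose d := Num.sqrt (b ^+ 2 - s ^+ 2).
have d_gt0 : 0 < d by rewrite sqrtr_gt0.
have d2 : d ^+ 2 = b ^+ 2 - s ^+ 2 by rewrite sqr_sqrtr// ltW.
exists (s * enorm y / (b * d)); set t := _ / _.
have nE : enorm (t *: X + y) = enorm y * b / d.
  apply/eqP; rewrite -(@eqrXn2 _ 2)//; last 2 first.
  - exact: enorm_ge0.
  - by rewrite !mulr_ge0 ?invr_ge0// ltW.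
  have sd : s ^+ 2 + d ^+ 2 = b ^+ 2 by rewrite d2 addrC subrK.
  have tE : b ^+ 2 * t ^+ 2 + enorm y ^+ 2 = enorm y ^+ 2 * (s ^+ 2 + d ^+ 2) / d ^+ 2.
    by rewrite /t; field; rewrite !gt_eqF.
  rewrite enorm_line// tE sd; apply/eqP.
  by field; rewrite !gt_eqF.
rewrite /slope dotX_line// nE /t.
by field; rewrite !gt_eqF.
Qed.

Hypothesis br_skew : forall u v, br u v = - br v u.

Lemma br_self u : br u u = 0.
Proof.
apply/eqP; have /eqP := br_skew u u; rewrite -addr_eq0 -mulr2n -scaler_nat.
by rewrite scaler_eq0 pnatr_eq0.
Qed.

Let br_addr u v w : br u (v + w) = br u v + br u w.
Proof. by rewrite -[v in LHS]scale1r brr scale1r. Qed.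

Let br_scaler k u v : br u (k *: v) = k *: br u v.
Proof.
have b0 : br u 0 = 0 by apply: (addrI (br u 0)); rewrite addr0 -br_addr addr0.
by rewrite -[k *: v in LHS]addr0 brr b0 addr0.
Qed.

Hypothesis kap_gt0 : forall s : R, `|s| <= b -> 0 < kap s.

Lemma slope_line (y : E) t : dot X y = 0 ->
  slope X (t *: X + y) * enorm (t *: X + y) = b ^+ 2 * t.
Proof.
move=> Xy; have [u0|u0] := eqVneq (t *: X + y) 0.
  by rewrite -(dotX_line t Xy) u0 /slope !dot0r !mul0r.
by rewrite -(dotX_line t Xy) /slope divfK// gt_eqF// enorm_gt0.
Qed.

Lemma line_neq0 (y : E) t : dot X y = 0 -> y != 0 -> t *: X + y != 0.
Proof.
move=> Xy y0; rewrite -dot_gt0 -sqr_enorm enorm_line//.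
apply: ltr_wpDl; first by rewrite mulr_ge0 ?sqr_ge0.
by rewrite exprn_gt0 ?enorm_gt0.
Qed.

(** The vector z0, a combination of w and z orthogonal to x and r, is orthogonal to
    every u = t x + eps r and does not depend on t.  Since u and t x - r have the
    same length and slope, subtracting the equations for eps = 1 and eps = -1
    leaves phi'(s) |u| = const * t kappa(s), and t = s |u| / b^2. *)
Lemma nonclosed_generic w r z :
  dot X w = 0 -> dot X r = 0 -> dot X z = 0 -> dot z r != 0 ->
  (forall u, dot X (br z u) = 0) -> dot X (br w r) != 0 ->
  exists K, forall s : R, `|s| < b -> phi1 s = K * s * kap s.
Proof.
move=> Xw Xr Xz zr Tz Twr.
have r0 : r != 0 by apply: contraNneq zr => ->; rewrite dot0r.
pose z0 := dot z r *: w - dot w r *: z.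
have Xz0 : dot X z0 = 0 by rewrite dotBr !dotZr Xw Xz !mulr0 subrr.
have rz0 : dot r z0 = 0 by rewrite dotBr !dotZr !(dotC r) mulrC subrr.
pose D := deviation z0 X r + deviation z0 r X.
have eq_u (eps : R) t : eps != 0 -> let u := t *: X + eps *: r in
    kap (slope X u) * (t ^+ 2 * deviation z0 X X + eps ^+ 2 * deviation z0 r r + t * eps * D) =
    phi1 (slope X u) * enorm u *
      (dot z r * (t * dot X (br w X) + eps * dot X (br w r))).
  move=> eps0 u; have u0 : u != 0.
    by apply: line_neq0; rewrite ?dotZr ?Xr ?mulr0// scaler_eq0 negb_or eps0.
  have := deviation_expand z0 X r 0 t eps 0.
  rewrite /= scaler0 addr0 -/u !(mul0r, mulr0, addr0) expr0n mul0r addr0 -/D => <-.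
  rewrite douglas_perp//; last by rewrite dotDl !dotZl Xz0 rz0 !mulr0 addr0.
  congr (_ * _); rewrite br_skew dotNr /z0 -scaleNr addrC brr dotDr dotZr.
  rewrite br_scaler dotZr (br_skew u z) (br_skew u w) !dotNr Tz /u.
  by rewrite br_addr !br_scaler dotDr !dotZr; ring.
exists (D / (dot z r * dot X (br w r)) / b ^+ 2) => s sb.
have [t st] := slope_surj Xr r0 sb.
have sb' : `|s| <= b by exact: ltW.
have Xnr : dot X (- r) = 0 by rewrite dotNr Xr oppr0.
have n_eq : enorm (t *: X - r) = enorm (t *: X + r).
  apply/eqP; rewrite -(@eqrXn2 _ 2) ?enorm_ge0// !enorm_line//.
  by rewrite [enorm (- r)]/enorm dotNl dotNr opprK.
have s_eq : slope X (t *: X - r) = s.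
  by rewrite -st /slope n_eq !dotX_line.
have N1 : -1 != 0 :> R by rewrite oppr_eq0 oner_eq0.
have := eq_u _ t (oner_neq0 R); have := eq_u _ t N1.
rewrite /= scale1r scaleN1r s_eq st n_eq.
have := slope_line t Xr; rewrite st.
have := kap_gt0 sb'; have := enorm_gt0 (line_neq0 t Xr r0).
move: zr Twr b_gt0; rewrite -/b.
clear eq_u; clearbody D.
move: (kap s) (phi1 s) (enorm (_ + _)) (dot z r) (dot X (br w X)) (dot X (br w r))
  (deviation z0 X X) (deviation z0 r r) D b => k p1 m zr T0 T1 A B D' b' zr0 T10 b0 m0 k0 sm e2 e1.
have E : D' * t * k = p1 * m * zr * T1 by lra.
have m_neq : m != 0 by rewrite gt_eqF.
have b_neq : b' != 0 by rewrite gt_eqF.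
have tE : t = s * m / b' ^+ 2 by rewrite sm mulrC mulKf// expf_neq0.
move: E; rewrite tE => E.
apply: (mulIf m_neq); apply: (mulIf zr0); apply: (mulIf T10).
by rewrite -E; field; rewrite ?zr0 ?T10 ?b_neq.
Qed.

(** Adding z to r changes none of the other hypotheses, because z is in the kernel
    of the 2-form. *)
Lemma nonclosed w r z :
  dot X w = 0 -> dot X r = 0 -> dot X z = 0 -> z != 0 ->
  (forall u, dot X (br z u) = 0) -> dot X (br w r) != 0 ->
  exists K, forall s : R, `|s| < b -> phi1 s = K * s * kap s.
Proof.
move=> Xw Xr Xz z0 Tz Twr; have [zr|zr] := eqVneq (dot z r) 0; last first.
  exact: (nonclosed_generic Xw Xr Xz zr Tz Twr).
apply: (@nonclosed_generic w (r + z) z) => //.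
- by rewrite dotDr Xr Xz addr0.
- by rewrite dotDr zr add0r dot_eq0.
- by rewrite br_addr dotDr (br_skew w z) dotNr Tz oppr0 addr0.
Qed.

Local Notation Delta s := (kap s + (b ^+ 2 - s ^+ 2) * phi2 s).
Hypothesis Delta_gt0 : forall s : R, `|s| <= b -> 0 < Delta s.

(** In the projective equation with z = X, both kappa and the term ds(X) ds(Q(u))
    multiply the pairing of Q(u) with the part of X orthogonal to u; together they
    give Delta. *)
Lemma closed_identity u : u != 0 -> (forall z, dot X (br z u) = 0) ->
  let s := slope X u in let m := enorm u in
  phi2 s * (b ^+ 2 * m ^+ 2 - dot X u ^+ 2) * dot u (br X u) =
  Delta s * (dot X u * deviation u u u - m ^+ 2 * deviation X u u).
Proof.
move=> u0 Tu s m; have m_gt0 : 0 < m by exact: enorm_gt0.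
have := douglas X u0; rewrite /ab_hess /ab_diff Tu mulr0 addr0 /dslope -/s -/m.
rewrite (dotC u X) -sqr_enorm /deviation br_self dot0r subr0.
have m_neq : m != 0 by rewrite gt_eqF.
have -> : dot X u = s * m by rewrite /s /slope divfK.
clearbody m s.
move: (kap s) (phi2 s) (dot X _) (dot u (Q u u)) (dot u (br X u)) b => k p2 Xq uq r b' H.
have E : (k + (b' ^+ 2 - s ^+ 2) * p2) * (Xq - s * uq / m) = k * r.
  transitivity (m * (k * (r / m))); last by field.
  by rewrite -H; field.
transitivity (m ^+ 2 * ((k + (b' ^+ 2 - s ^+ 2) * p2) * r - k * r)); first by ring.
by rewrite -E; field.
Qed.

(** On the space spanned by X, v, w the deviations of v, w, X are quadratic forms in
    (t, p, q).  Orthogonality to X makes the first two proportional to p and q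
    ([proportional]), and [main] ties phi'' / Delta to the third.  Evaluating
    at (t,0,1), (t,1,0), (t,1,1) and (t,1,-1) leaves of all the coefficients
    only the one of p q in the third form, which is the constant sought. *)
Lemma closed_generic v w :
  dot X v = 0 -> dot X w = 0 -> dot v v = 1 -> dot w w = 1 -> dot v w = 0 ->
  (forall u z, dot X (br z u) = 0) ->
  dot v (br X v) = 0 -> dot w (br X w) = 0 ->
  dot v (br X w) + dot w (br X v) != 0 ->
  exists k, forall s : R, `|s| < b -> phi2 s = k * Delta s.
Proof.
move=> Xv Xw vv ww vw T rv rw r0.
pose u (t p q : R) := t *: X + p *: v + q *: w.
have uE t p q : u t p q = t *: X + (p *: v + q *: w) by rewrite /u addrA.
have Xy p q : dot X (p *: v + q *: w) = 0.
  by rewrite dotDr !dotZr Xv Xw !mulr0 addr0.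
have nE t p q : enorm (u t p q) ^+ 2 = b ^+ 2 * t ^+ 2 + (p ^+ 2 + q ^+ 2).
  rewrite uE enorm_line//; congr (_ + _).
  by rewrite sqr_enorm !(dotDl, dotDr, dotZl, dotZr) (dotC w v) vv ww vw; ring.
have u_neq0 t p q : p ^+ 2 + q ^+ 2 != 0 -> u t p q != 0.
  move=> pq; rewrite -dot_eq0 -sqr_enorm nE gt_eqF// ltr_wpDl//.
    by rewrite mulr_ge0 ?sqr_ge0.
  by rewrite lt_neqAle eq_sym pq addr_ge0 ?sqr_ge0.
have XuE t p q : dot X (u t p q) = b ^+ 2 * t by rewrite uE dotX_line.
have proportional t p q : p ^+ 2 + q ^+ 2 != 0 ->
    q * deviation v (u t p q) (u t p q) = p * deviation w (u t p q) (u t p q).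
  move=> pq; have u0 := u_neq0 t p q pq.
  have Xz : dot X (q *: v - p *: w) = 0 by rewrite dotBr !dotZr Xv Xw !mulr0 subrr.
  have uz : dot (u t p q) (q *: v - p *: w) = 0.
    rewrite /u !(dotDl, dotZl) Xz !(dotBr, dotZr) (dotC w v) vv ww vw.
    by ring.
  have := douglas_perp u0 Xz uz; rewrite T mulr0 => /eqP.
  rewrite mulf_eq0 gt_eqF ?kap_gt0 ?norm_slope_le//= => /eqP.
  have dl := deviation_scalar (u t p q) (u t p q).
  rewrite addrC -scaleNr dl (scalar_scale _ _ dl) => H.
  by apply: subr0_eq; rewrite -H; ring.
have main t p q : p ^+ 2 + q ^+ 2 != 0 -> let s := slope X (u t p q) in
    phi2 s * b ^+ 2 * (p ^+ 2 + q ^+ 2) *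
      (p * q * (dot v (br X w) + dot w (br X v))) =
    Delta s * (b ^+ 2 * t * (p * deviation v (u t p q) (u t p q) +
      q * deviation w (u t p q) (u t p q)) -
      (p ^+ 2 + q ^+ 2) * deviation X (u t p q) (u t p q)).
  move=> pq; have := closed_identity (u_neq0 t p q pq) (T _).
  rewrite /= XuE nE.
  have dl := deviation_scalar (u t p q) (u t p q).
  have -> : deviation (u t p q) (u t p q) (u t p q) = t * deviation X (u t p q) (u t p q) +
      p * deviation v (u t p q) (u t p q) + q * deviation w (u t p q) (u t p q).
    rewrite {1}/u -addrA dl (dl p) (scalar_scale _ _ dl); ring.
  have -> : dot (u t p q) (br X (u t p q)) = p * q * (dot v (br X w) + dot w (br X v)).
    rewrite /u !br_addr !br_scaler br_self scaler0 add0r.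
    by rewrite !(dotDl, dotDr, dotZl, dotZr) !T rv rw; ring.
  move: (deviation X _ _) (deviation v _ _) (deviation w _ _) (slope _ _) (dot v _) (dot w _).
  move=> dX dv dw s d1 d2 H.
  transitivity (phi2 s * (b ^+ 2 * (b ^+ 2 * t ^+ 2 + (p ^+ 2 + q ^+ 2)) -
    (b ^+ 2 * t) ^+ 2) * (p * q * (d1 + d2))); first by ring.
  by rewrite H; ring.
have nz_p0 : (0 : R) ^+ 2 + 1 ^+ 2 != 0 by rewrite expr0n expr1n add0r oner_neq0.
have nz_1p (e : R) : 1 ^+ 2 + e ^+ 2 != 0.
  by rewrite gt_eqF// expr1n ltr_pwDl// sqr_ge0.
pose cf z := (deviation z X X, deviation z v v, deviation z w w, deviation z X v + deviation z v X,
  deviation z X w + deviation z w X, deviation z v w + deviation z w v).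
have dE z t p q : deviation z (u t p q) (u t p q) =
    t ^+ 2 * (cf z).1.1.1.1.1 + p ^+ 2 * (cf z).1.1.1.1.2 + q ^+ 2 * (cf z).1.1.1.2
    + t * p * (cf z).1.1.2 + t * q * (cf z).1.2 + p * q * (cf z).2.
  exact: deviation_expand.
move: dE proportional main; clearbody cf; case Ev : (cf v) => [[[[[a1 a2] a3] a4] a5] a6].
case Ew : (cf w) => [[[[[b1 b2] b3] b4] b5] b6].
case Ex : (cf X) => [[[[[x1 x2] x3] x4] x5] x6].
move=> dE; have dv t p q := dE v t p q; have dw t p q := dE w t p q.
have dX t p q := dE X t p q; rewrite Ev /= in dv; rewrite Ew /= in dw.
rewrite Ex /= in dX; move=> P Mn.
have P1 := P 0 0 1 nz_p0; have P2 := P 1 0 1 nz_p0; have P3 := P (-1) 0 1 nz_p0.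
have P4 := P 0 1 0 (nz_1p 0); have P5 := P 1 1 0 (nz_1p 0).
have P6 := P (-1) 1 0 (nz_1p 0).
have P7 := P 0 1 1 (nz_1p 1); have P8 := P 0 1 (-1) (nz_1p (-1)).
rewrite !(dv, dw) in P1 P2 P3 P4 P5 P6 P7 P8.
have a5_0 : a5 = 0 by lra.
have a6_b3 : a6 = b3 by lra.
have b1_0 : b1 = 0 by lra.
have M1 t : b ^+ 2 * t * deviation w (u t 0 1) (u t 0 1) = deviation X (u t 0 1) (u t 0 1).
  have := Mn t 0 1 nz_p0; rewrite /= !(mul0r, mulr0) => /esym/eqP.
  rewrite mulf_eq0 gt_eqF ?Delta_gt0 ?norm_slope_le//= => /eqP H.
  by apply: subr0_eq; rewrite -[RHS]H; ring.
have M2 := M1 1; have M3 := M1 (-1); rewrite !(dw, dX) in M2 M3.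
have x5E : x5 = b ^+ 2 * b3 by rewrite b1_0 in M2 M3; lra.
exists (- x6 / (b ^+ 2 * (dot v (br X w) + dot w (br X v)))) => s sb.
have y0 : 1 *: v + 1 *: w != 0 :> E.
  by rewrite !scale1r -dot_gt0 !(dotDl, dotDr) (dotC w v) vv ww vw; lra.
(* (t,1,1) and (t,1,-1) have the same slope. *)
have [t] := slope_surj (Xy 1 1) y0 sb; rewrite -uE => st.
have st' : slope X (u t 1 (-1)) = s.
  rewrite -st /slope !XuE; congr (_ / _).
  by apply/eqP; rewrite -(@eqrXn2 _ 2) ?enorm_ge0// !nE sqrrN.
have sb' : `|s| <= b by exact: ltW.
have := Mn t 1 1 (nz_1p 1); have := Mn t 1 (-1) (nz_1p (-1)); rewrite /= st st'.
have P9 := P t 1 1 (nz_1p 1); have P10 := P t 1 (-1) (nz_1p (-1)).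
rewrite !mul1r mulN1r in P9 P10; rewrite -P9 -P10 !(dv, dX) a5_0 a6_b3 x5E.
move: r0 b_gt0 (Delta_gt0 sb'); move: (dot v _ + dot w _) b (phi2 s) (Delta s).
move=> r0 b' p2 D r0_neq b_gt D_gt H1 H2.
have E : p2 * b' ^+ 2 * r0 = - x6 * D by lra.
have b_neq : b' != 0 by rewrite gt_eqF.
apply: (mulIf r0_neq); apply: (@mulIf _ (b' ^+ 2)); first by rewrite expf_neq0.
by rewrite mulrAC E; field; rewrite ?r0_neq ?b_neq.
Qed.

End DouglasAlgebra.

(** * Ordinary differential equations for phi *)

Section ODE.
Context {R : realType}.
Implicit Types (f g : R -> R) (b s : R).

Lemma is_derive_continuous f s df : is_derive s 1 f df -> {for s, continuous f}.
Proof. by move=> [/derivable1_diffP/differentiable_continuous]. Qed.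

(** The extreme slopes s = b and s = - b occur only at multiples of x, where the lines
    used above give no information; continuity covers them. *)
Lemma closure_zero f b : 0 < b -> (forall s, `|s| <= b -> {for s, continuous f}) ->
  (forall s, `|s| < b -> f s = 0) -> forall s, `|s| <= b -> f s = 0.
Proof.
move=> b0 cf f0 s sb; apply/eqP; apply: contraT => fs.
have : \forall r \near s, f r != 0.
  have := cf s sb => /(_ (fun r => r != 0)); apply.
  exact: (near_neq0 fs).
move=> /nbhs_ballP[e /= e0 near_s].
(* s (1 - d) is within e of s and strictly inside the interval. *)
pose d := Num.min (e / (2 * b)) 2^-1.
have d0 : 0 < d by rewrite lt_min invr_gt0 ltr0n divr_gt0 ?mulr_gt0.
have d1 : d <= 2^-1 by rewrite ge_min lexx orbT.
have /near_s : ball s e (s * (1 - d)).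
  rewrite -ball_normE /= (_ : s - s * (1 - d) = s * d); last by ring.
  rewrite normrM (gtr0_norm d0); apply: (@le_lt_trans _ _ (b * (e / (2 * b)))).
    by apply: ler_pM => //; [exact: ltW|rewrite /d ge_min lexx].
  rewrite (_ : b * _ = e / 2); last by field; rewrite gt_eqF.
  by rewrite ltr_pdivrMr// ltr_pMr// ltr1n.
have d1' : 1 - d < 1 by lra.
have d2' : 0 < 1 - d by lra.
rewrite f0 ?eqxx// normrM (gtr0_norm d2').
by have := mulr_ge0 (normr_ge0 s) (ltW d0); nra.
Qed.

Lemma constant_of_derive0 g b : 0 < b ->
  (forall s, `|s| <= b -> {for s, continuous g}) ->
  (forall s, `|s| < b -> is_derive s 1 g 0) ->
  forall s, `|s| <= b -> g s = g 0.
Proof.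
move=> b0 cg dg s sb; apply: subr0_eq.
apply: (@closure_zero (fun r => g r - g 0) b) sb => // r rb.
  by apply: continuousB; [exact: cg|exact: cst_continuous].
have lineE (t : R) : 0 + t *: (1 : R) = t by rewrite add0r [t%:A]mulr1.
have [|t tr] := @MVT_line R R g 0 1 r.
  by move=> t tr; rewrite lineE; have [] := dg t (le_lt_trans tr rb).
rewrite !lineE; have [_ ->] := dg t (le_lt_trans tr rb).
by rewrite mulr0.
Qed.

Lemma is_derive_quadratic (p q r : R) :
  is_derive r 1 (fun s : R => p + q * s ^+ 2) (2 * q * r).
Proof.
have dsq := is_derive_sqr (is_derive_id r (1 : R)).
have := is_deriveD (is_derive_cst p r 1) (is_deriveM (is_derive_cst q r 1) dsq).
by move=> H; apply: (is_derive_eq H); rewrite /GRing.scale/=; ring.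
Qed.

Variables (phi phi1 phi2 : R -> R) (b : R).
Hypothesis b_gt0 : 0 < b.
Hypothesis dphi : forall s, `|s| <= b -> is_derive s 1 phi (phi1 s).
Hypothesis dphi1 : forall s, `|s| <= b -> is_derive s 1 phi1 (phi2 s).
Hypothesis phi_gt0 : forall s, `|s| <= b -> 0 < phi s.
Local Notation kap := (kappa phi phi1).
Hypothesis kap_gt0 : forall s, `|s| <= b -> 0 < kap s.

(** The equation says phi = kappa (1 + K s^2), so that the quotient
    phi^2 / (1 + K s^2) has derivative zero. *)
Lemma riemannian_ode K : (forall s, `|s| < b -> phi1 s = K * s * kap s) ->
  forall s, `|s| <= b -> 0 < 1 + K * s ^+ 2 /\
    phi s ^+ 2 = phi 0 ^+ 2 * (1 + K * s ^+ 2).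
Proof.
move=> ode.
have odeb s : `|s| <= b -> phi1 s = K * s * kap s.
  move=> sb; apply: subr0_eq.
  apply: (@closure_zero (fun s => phi1 s - K * s * kap s) b) => // [r rb|r rb].
    have c := is_derive_continuous (dphi rb); have c1 := is_derive_continuous (dphi1 rb).
    rewrite /kappa; apply: continuousB => //; apply: continuousM.
      by apply: continuousM; [exact: cst_continuous|exact: cvg_id].
    by apply: continuousB => //; apply: continuousM => //; exact: cvg_id.
  by rewrite ode// subrr.
have phiE s : `|s| <= b -> phi s = kap s * (1 + K * s ^+ 2).
  move=> sb; have -> : kap s * (1 + K * s ^+ 2) = kap s + s * (K * s * kap s) by ring.
  by rewrite -odeb// /kappa; ring.
have mu_gt0 s : `|s| <= b -> 0 < 1 + K * s ^+ 2.
  by move=> sb; have := phi_gt0 sb; rewrite phiE// pmulr_rgt0// kap_gt0.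
move=> s sb; split; first exact: mu_gt0.
pose g s := phi s ^+ 2 / (1 + K * s ^+ 2).
have dg (r : R) : `|r| <= b -> is_derive r 1 g 0.
  move=> rb; have mr : 1 + K * r ^+ 2 != 0 by rewrite gt_eqF// mu_gt0.
  have d3 := is_deriveM (is_derive_sqr (dphi rb))
    (@is_deriveV R (fun s => 1 + K * s ^+ 2) r _ 1 mr (is_derive_quadratic 1 K r)).
  apply: (is_derive_eq d3); rewrite /GRing.scale/= odeb//.
  have kE : kap r = phi r / (1 + K * r ^+ 2) by rewrite phiE// mulfK.
  rewrite kE; move: mr; move: (phi r) => p mr; field.
  by [].
have cg r rb := is_derive_continuous (dg r rb).
have := constant_of_derive0 b_gt0 cg (fun r rb => dg r (ltW rb)) sb.
rewrite /g expr0n mulr0 addr0 divr1 => <-.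
by rewrite divfK// gt_eqF// mu_gt0.
Qed.

Hypothesis Delta_gt0 : forall s, `|s| <= b -> 0 < kap s + (b ^+ 2 - s ^+ 2) * phi2 s.

(** With mu = m + k s^2 the equation reads mu phi'' = k kappa.  As
    kappa' = - s phi'', the product kappa sqrt(mu) is constant; therefore phi''
    is the second derivative of C sqrt(mu) with C = phi(0) / sqrt(m), and the
    difference is affine, vanishing at 0.  Since mu(b) = mu(-b) = 1, the last inequality is
    the positivity of phi at the two ends. *)
Lemma randers_ode k :
  (forall s, `|s| < b -> phi2 s = k * (kap s + (b ^+ 2 - s ^+ 2) * phi2 s)) ->
  let m := 1 - k * b ^+ 2 in
  exists eps C : R, [/\ 0 < C,
    forall s, `|s| <= b -> 0 < m + k * s ^+ 2,
    forall s, `|s| <= b -> phi s = eps * s + C * Num.sqrt (m + k * s ^+ 2)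
    & `|eps| * b < C].
Proof.
move=> ode m.
pose mu s := m + k * s ^+ 2.
have muE s : (b ^+ 2 - s ^+ 2) * k = 1 - mu s by rewrite /mu /m; ring.
have mu_gt0 s : `|s| <= b -> 0 < mu s.
  move=> sb; move: (sb); rewrite le_eqVlt => /orP[/eqP sE|sb'].
    rewrite /mu /m -sE real_normK ?num_real//.
    by rewrite (_ : _ + _ = 1)//; ring.
  have H : kap s = mu s * (kap s + (b ^+ 2 - s ^+ 2) * phi2 s).
    rewrite {1}(_ : kap s = (kap s + (b ^+ 2 - s ^+ 2) * phi2 s) -
       (b ^+ 2 - s ^+ 2) * phi2 s); last by ring.
    by rewrite {2}ode// mulrA muE; ring.
  have := kap_gt0 sb; rewrite H pmulr_lgt0//; exact: Delta_gt0.
have mu0 : mu 0 = m by rewrite /mu expr0n mulr0 addr0.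
have b00 : `|0 : R| <= b by rewrite normr0 ltW.
have m_gt0 : 0 < m by rewrite -mu0 mu_gt0.
have phi2E s : `|s| < b -> mu s * phi2 s = k * kap s.
  move=> sb; have -> : mu s = 1 - (b ^+ 2 - s ^+ 2) * k by rewrite muE; ring.
  by rewrite mulrBl mul1r {1}(ode s sb); ring.
pose rt s := Num.sqrt (mu s).
have rt_gt0 s : `|s| <= b -> 0 < rt s by move=> sb; rewrite sqrtr_gt0 mu_gt0.
have rt2 s : `|s| <= b -> rt s ^+ 2 = mu s.
  by move=> sb; rewrite sqr_sqrtr// ltW// mu_gt0.
have d_rt s : `|s| <= b -> is_derive s 1 rt (k * s / rt s).
  move=> sb; have H := is_derive_comp_scalar (is_derive_quadratic m k s)
    (is_derive1_sqrt (mu_gt0 s sb)).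
  apply: (is_derive_eq H); rewrite -/(mu s) -/(rt s); field.
  by rewrite gt_eqF// rt_gt0.
have d_kap s : `|s| <= b -> is_derive s 1 kap (- (s * phi2 s)).
  move=> sb; have H := is_deriveB (dphi sb) (is_deriveM (is_derive_id s 1) (dphi1 sb)).
  by apply: (is_derive_eq H); rewrite /GRing.scale/=; ring.
have rt0 : rt 0 = Num.sqrt m by rewrite /rt mu0.
have kap0 : kap 0 = phi 0 by rewrite /kappa mul0r subr0.
have sqrt_m_neq : Num.sqrt m != 0 by rewrite gt_eqF// sqrtr_gt0.
have kap_rt s : `|s| <= b -> kap s * rt s = phi 0 * Num.sqrt m.
  move=> sb; rewrite -kap0 -rt0.
  have d (r : R) : `|r| <= b -> is_derive r 1 (fun s => kap s * rt s)
      (kap r * (k * r / rt r) + rt r * (- (r * phi2 r))).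
    by move=> rb; exact: (is_deriveM (d_kap r rb) (d_rt r rb)).
  apply: (@constant_of_derive0 (fun s => kap s * rt s) b) sb => // r rb.
    exact: is_derive_continuous (d r rb).
  apply: (is_derive_eq (d r (ltW rb))).
  have rn : rt r != 0 by rewrite gt_eqF// rt_gt0// ltW.
  rewrite (_ : _ + _ = r / rt r * (k * kap r - rt r ^+ 2 * phi2 r)); last by field.
  by rewrite rt2 ?(ltW rb)// phi2E// subrr mulr0.
pose C := phi 0 / Num.sqrt m.
have C_gt0 : 0 < C by rewrite divr_gt0 ?sqrtr_gt0// phi_gt0.
have d_h s : `|s| <= b -> is_derive s 1 (fun s => phi1 s - C * k * (s / rt s))
    (phi2 s - C * k * (m / rt s ^+ 3)).
  move=> sb; have rn : rt s != 0 by rewrite gt_eqF// rt_gt0.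
  have H := is_deriveB (dphi1 sb) (is_deriveM (is_derive_cst (C * k) s 1)
    (is_deriveM (is_derive_id s 1) (@is_deriveV R rt s _ 1 rn (d_rt s sb)))).
  apply: (is_derive_eq H); rewrite /GRing.scale/= !fctE.
  have -> : m = rt s ^+ 2 - k * s ^+ 2 by rewrite rt2// /mu; ring.
  by field.
have hE s : `|s| <= b -> phi1 s - C * k * (s / rt s) = phi1 0.
  move=> sb; have -> : phi1 0 = phi1 0 - C * k * (0 / rt 0) by rewrite mul0r mulr0 subr0.
  apply: (@constant_of_derive0 (fun s => phi1 s - C * k * (s / rt s)) b) sb => // r rb.
    exact: is_derive_continuous (d_h r rb).
  apply: (is_derive_eq (d_h r (ltW rb))).
  have rb' := ltW rb; have rn : rt r != 0 by rewrite gt_eqF// rt_gt0.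
  have CmE : C * m = kap r * rt r.
    have mE : m = Num.sqrt m * Num.sqrt m by rewrite -expr2 sqr_sqrtr// ltW.
    by rewrite kap_rt// /C {2}mE mulrA divfK.
  have -> : phi2 r = k * kap r / rt r ^+ 2.
    by rewrite rt2// -phi2E// mulrC mulKf// gt_eqF// mu_gt0.
  have -> : C * k * (m / rt r ^+ 3) = k * (C * m) / rt r ^+ 3 by field.
  by rewrite CmE; field.
exists (phi1 0), C.
have phiE s : `|s| <= b -> phi s = phi1 0 * s + C * rt s.
  move=> sb; apply: subr0_eq.
  have d (r : R) : `|r| <= b -> is_derive r 1 (fun s => phi s - (phi1 0 * s + C * rt s)) 0.
    move=> rb; have H := is_deriveB (dphi rb) (is_deriveD
      (is_deriveM (is_derive_cst (phi1 0) r 1) (is_derive_id r 1))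
      (is_deriveM (is_derive_cst C r 1) (d_rt r rb))).
    apply: (is_derive_eq H); rewrite /GRing.scale/= -[RHS](subrr (phi1 0)).
    by rewrite -{1}(hE r rb); ring.
  have E0 : phi 0 - (phi1 0 * 0 + C * rt 0) = 0.
    by rewrite mulr0 add0r rt0 /C divfK// subrr.
  rewrite -[RHS]E0.
  apply: (@constant_of_derive0 (fun s => phi s - (phi1 0 * s + C * rt s)) b) sb => // r rb.
    exact: is_derive_continuous (d r rb).
  exact: d r (ltW rb).
have bb : `|b| <= b by rewrite gtr0_norm.
have bNb : `|- b| <= b by rewrite normrN gtr0_norm.
have rtb : rt b = 1 by rewrite /rt /mu /m subrK sqrtr1.
have rtNb : rt (- b) = 1 by rewrite /rt /mu /m sqrrN subrK sqrtr1.
split=> //.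
have := phi_gt0 bb; have := phi_gt0 bNb; rewrite !phiE// rtb rtNb => H1 H2.
rewrite -{1}(gtr0_norm b_gt0) -normrM ltr_norml.
by apply/andP; split; lra.
Qed.

End ODE.

(** * The Lie algebra *)

Section L57Algebra.
Context {R : realType}.
Local Notation E := 'rV[R]_5.
Implicit Types u v w z y : E.
Local Notation co u k := (u 0 (inord k)).

(** The indices are written with [inord] because the brackets are given that way. *)
Lemma sum5 (V : nmodType) (f : 'I_5 -> V) : \sum_i f i =
  f (inord 0) + f (inord 1) + f (inord 2) + f (inord 3) + f (inord 4).
Proof.
rewrite !big_ord_recl big_ord0 addr0 !addrA.
by congr (f _ + f _ + f _ + f _ + f _); apply: val_inj; rewrite /= inordK.
Qed.

Local Notation unit_vec k := (delta_mx 0 (inord k) : E).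

Lemma dot_unit u k : dot u (unit_vec k) = (co u k).
Proof.
rewrite /dot (bigD1 (inord k))//= mxE !eqxx mulr1 big1 ?addr0// => i ik.
by rewrite mxE (negPf ik) mulr0.
Qed.

Lemma inord5_eq j k : (j < 5)%N -> (k < 5)%N ->
  (inord j == inord k :> 'I_5) = (j == k).
Proof. by move=> j5 k5; rewrite -val_eqE/= !inordK. Qed.

Lemma unit_entry j k : (j < 5)%N -> (k < 5)%N -> co (unit_vec j) k = (k == j)%:R.
Proof. by move=> j5 k5; rewrite mxE eqxx/= inord5_eq. Qed.

Variables (X : E) (phi phi1 phi2 : R -> R) (Q br : E -> E -> E).
Variables (a b c d f g : R).
Hypotheses (a0 : a != 0) (d0 : d != 0) (g0 : g != 0).
Hypothesis br_form : forall y z u, dot y (br z u) =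
  ((co z 0) * (co u 1) - (co z 1) * (co u 0)) * (a * (co y 2) + b * (co y 3) + c * (co y 4)) +
  ((co z 0) * (co u 2) - (co z 2) * (co u 0)) * (d * (co y 3) + f * (co y 4)) +
  ((co z 0) * (co u 3) - (co z 3) * (co u 0)) * (g * (co y 4)).
Hypothesis Ql : forall u, linear (Q^~ u).
Hypothesis Qr : forall u, linear (Q u).
Hypothesis brl : forall u, linear (br^~ u).
Hypothesis brr : forall u, linear (br u).
Hypothesis br_skew : forall u v, br u v = - br v u.
Hypothesis douglas : forall u z, u != 0 ->
  ab_hess X phi phi1 phi2 u z (Q u u) = ab_diff X phi phi1 u (br z u).
Hypothesis X0 : X != 0.
Local Notation kap := (kappa phi phi1).
Hypothesis kap_gt0 : forall s : R, `|s| <= enorm X -> 0 < kap s.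
Hypothesis Delta_gt0 : forall s : R, `|s| <= enorm X ->
  0 < kap s + (enorm X ^+ 2 - s ^+ 2) * phi2 s.

Let entries := (mxE, eqxx, inord5_eq).

(** The 2-form is <X, [z, u]> = z0 l(u) - u0 l(z), where l has the coefficients
    a X2 + b X3 + c X4, d X3 + f X4, g X4 on the entries 1, 2, 3.  As a, d, g are
    nonzero, it vanishes only if X2 = X3 = X4 = 0.  If one of these entries is nonzero,
    the last such entry gives three test vectors orthogonal to X.  If all are
    zero, X lies in the span of the frame vectors 0 and 1, and the test pair
    consists of the frame vectors 2, 3 when X0 is nonzero and 0, 2 when it is
    not. *)
Lemma l57_douglas :
  (exists K, forall s : R, `|s| < enorm X -> phi1 s = K * s * kap s) \/
  (exists k, forall s : R, `|s| < enorm X ->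
     phi2 s = k * (kap s + (enorm X ^+ 2 - s ^+ 2) * phi2 s)).
Proof.
have nonclosedX := nonclosed Ql Qr brr douglas X0 br_skew kap_gt0.
have closedX := closed_generic Ql Qr brl brr douglas X0 br_skew kap_gt0 Delta_gt0.
have dotE (u : E) j k p q : dot u (p *: unit_vec j - q *: unit_vec k) =
    p * (co u j) - q * (co u k).
  by rewrite dotBr !dotZr !dot_unit.
have entE j k p q l : (j < 5)%N -> (k < 5)%N -> (l < 5)%N ->
    co (p *: unit_vec j - q *: unit_vec k) l = p * (l == j)%:R - q * (l == k)%:R.
  by move=> j5 k5 l5; rewrite !mxE !eqxx/= !inord5_eq.
have [x4|x4] := eqVneq (co X 4) 0; last first.
  (* In the third vector the entries 1 and 3 annihilate l, and the entry 4, on which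
     l does not depend, makes it orthogonal to X. *)
  left; apply: (@nonclosedX ((co X 4) *: unit_vec 0 - (co X 0) *: unit_vec 4)
    ((co X 4) *: unit_vec 3 - (co X 3) *: unit_vec 4)
    ((co X 4) * (g * (co X 4)) *: unit_vec 1
     - ((co X 4) * (a * (co X 2) + b * (co X 3) + c * (co X 4)) *: unit_vec 3
     - (- (g * (co X 4) * (co X 1))
        + (a * (co X 2) + b * (co X 3) + c * (co X 4)) * (co X 3)) *: unit_vec 4))).
  - by rewrite dotE mulrC subrr.
  - by rewrite dotE mulrC subrr.
  - by rewrite dotBr dotE dotZr !dot_unit; ring.
  - apply/eqP => /rowP/(_ (inord 1)); rewrite !entries//= => /eqP.
    by rewrite !(mulr0, mulr1, subr0, oppr0, addr0) !mulf_eq0 (negPf g0) (negPf x4).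
  - by move=> u; rewrite br_form !entries//=; ring.
  - rewrite br_form !entE//= (_ : _ + _ = (co X 4) * (co X 4) * (g * (co X 4))).
      by rewrite !mulf_neq0.
    by ring.
have [x3|x3] := eqVneq (co X 3) 0; last first.
  left; apply: (@nonclosedX ((co X 3) *: unit_vec 0 - (co X 0) *: unit_vec 3)
    ((co X 3) *: unit_vec 2 - (co X 2) *: unit_vec 3) (unit_vec 4)).
  - by rewrite dotE mulrC subrr.
  - by rewrite dotE mulrC subrr.
  - by rewrite dot_unit.
  - apply/eqP => /rowP/(_ (inord 4)); rewrite !entries//= => /eqP.
    by rewrite oner_eq0.
  - by move=> u; rewrite br_form !entries//=; ring.
  - rewrite br_form !entE//= x4 (_ : _ + _ = (co X 3) * (co X 3) * (d * (co X 3))).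
      by rewrite !mulf_neq0.
    by ring.
have [x2|x2] := eqVneq (co X 2) 0; last first.
  left; apply: (@nonclosedX ((co X 2) *: unit_vec 0 - (co X 0) *: unit_vec 2)
    ((co X 2) *: unit_vec 1 - (co X 1) *: unit_vec 2) (unit_vec 4)).
  - by rewrite dotE mulrC subrr.
  - by rewrite dotE mulrC subrr.
  - by rewrite dot_unit.
  - apply/eqP => /rowP/(_ (inord 4)); rewrite !entries//= => /eqP.
    by rewrite oner_eq0.
  - by move=> u; rewrite br_form !entries//=; ring.
  - rewrite br_form !entE//= x4 x3 (_ : _ + _ = (co X 2) * (co X 2) * (a * (co X 2))).
      by rewrite !mulf_neq0.
    by ring.
right; have T u z : dot X (br z u) = 0.
  by rewrite br_form x2 x3 x4; ring.
have unit_dot j k : (j < 5)%N -> (k < 5)%N -> dot (unit_vec j) (unit_vec k) = (k == j)%:R.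
  by move=> j5 k5; rewrite dot_unit unit_entry.
have [x0|x0] := eqVneq (co X 0) 0.
  have x1 : (co X 1) != 0.
    apply: contraNneq X0 => x1; rewrite -dot_eq0 /dot sum5 x0 x1 x2 x3 x4.
    by rewrite !mulr0 !addr0.
  apply: (@closedX (unit_vec 0) (unit_vec 2)) => //;
    rewrite ?dot_unit ?unit_dot//= ?br_form ?x0 ?x2 ?entries//=.
  - by ring.
  - by ring.
  - by rewrite (_ : _ + _ = - ((co X 1) * a)) ?oppr_eq0 ?mulf_neq0//; ring.
apply: (@closedX (unit_vec 2) (unit_vec 3)) => //;
    rewrite ?dot_unit ?unit_dot//= ?br_form ?x3 ?x2 ?entries//=.
- by ring.
- by ring.
- rewrite [X in X != 0](_ : _ = co X 0 * d); first by rewrite mulf_neq0.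
  by ring.
Qed.

End L57Algebra.

Section Bracket.
Context {R : realType} {G : groupTopologicalType}.
Local Notation E := 'rV[R]_5.
Variable L : lie_structure R 4 G.
Variable atilde : forall p : G, tangent R 4 p -> tangent R 4 p -> R.
Hypothesis atilde_riemannian : riemannian_metric L atilde.
Variable e : 'I_5 -> vector_field R 4 G.
Hypothesis e_orthonormal : orthonormal_frame L atilde e.
Local Notation br := (bracket L atilde e).
Local Notation bc := (bracket_coef L atilde e).

Variables (a b c d f g : R).
Hypothesis e_brackets : l57_brackets L a b c d f g e.

(** The brackets with indices in decreasing or equal order follow by skew-symmetry;
    [w] collects the three nonzero ones. *)
Lemma l57_bracket_form (y z u : E) : dot y (br z u) =
  (z 0 (inord 0) * u 0 (inord 1) - z 0 (inord 1) * u 0 (inord 0)) *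
    (a * y 0 (inord 2) + b * y 0 (inord 3) + c * y 0 (inord 4)) +
  (z 0 (inord 0) * u 0 (inord 2) - z 0 (inord 2) * u 0 (inord 0)) *
    (d * y 0 (inord 3) + f * y 0 (inord 4)) +
  (z 0 (inord 0) * u 0 (inord 3) - z 0 (inord 3) * u 0 (inord 0)) *
    (g * y 0 (inord 4)).
Proof.
have frameE k : e (inord k) 1%g *m coframe L atilde e (chart_at L 1%g 1%g) =
    delta_mx 0 (inord k) by exact: frame_vec_coframe.
have [E12 E13 E14 E15 E0] := e_brackets 1%g.
pose w : nat -> E := nth 0 [:: 0;
  a *: delta_mx 0 (inord 2) + b *: delta_mx 0 (inord 3) + c *: delta_mx 0 (inord 4);
  d *: delta_mx 0 (inord 3) + f *: delta_mx 0 (inord 4); g *: delta_mx 0 (inord 4)].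
pose T (i j : nat) : E := if i is 0 then w j else if j is 0 then - w i else 0.
have T_lt (i j : nat) : (i < j < 5)%N -> bc (inord i) (inord j) = T i j.
  case: i => [|i] /andP[ij j5]; last first.
    rewrite /bracket_coef (E0 i.+2 j.+1) ?mul0mx//.
    by case: j ij {j5}.
  case: j ij j5 => [|[|[|[|[|j]]]]]//= _ _; rewrite /bracket_coef.
  - by rewrite E12 !mulmxDl -!scalemxAl !frameE.
  - by rewrite E13 !mulmxDl -!scalemxAl !frameE.
  - by rewrite E14 -!scalemxAl !frameE.
  - by rewrite E15 mul0mx.
have T_skew i j : T i j = - T j i.
  by case: i j => [|i] [|j]; rewrite /T ?opprK ?oppr0.
have T_all (i j : nat) : (i < 5)%N -> (j < 5)%N -> bc (inord i) (inord j) = T i j.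
  case: (ltngtP i j) => [ij _ j5|ji i5 _|<- _ _].
  - by rewrite T_lt// ij.
  - by rewrite bracket_coef_skew T_lt ?ji// -T_skew.
  - by rewrite /bracket_coef /vf_bracket subrr mul0mx; case: i.
have TE (i j : 'I_5) : bc i j = T i j.
  by have := T_all _ _ (ltn_ord i) (ltn_ord j); rewrite !inord_val.
have -> : br z u = \sum_i \sum_j (z 0 i * u 0 j) *: T i j.
  by apply: eq_bigr => i _; apply: eq_bigr => j _; rewrite TE.
have wdot k : dot y (w k) = nth 0 [:: 0;
    a * y 0 (inord 2) + b * y 0 (inord 3) + c * y 0 (inord 4);
    d * y 0 (inord 3) + f * y 0 (inord 4); g * y 0 (inord 4)] k.
  case: k => [|[|[|[|k]]]]; rewrite /w/=.
  - by rewrite dot0r.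
  - by rewrite !(dotDr, dotZr, dot_unit).
  - by rewrite !(dotDr, dotZr, dot_unit).
  - by rewrite dotZr dot_unit.
  - by rewrite !nth_nil dot0r.
rewrite sum5 !sum5 !inordK// /T !(dotDr, dotZr, dotNr, dot0r, wdot)/=.
by ring.
Qed.

End Bracket.

(** * Metrics with phi(s) = eps s + sqrt(P + K s^2) *)

Section Metrics.
Context {R : realType} {n : nat} {M : topologicalType}.
Local Notation E := 'rV[R]_n.+1.
Variables (S : smooth_structure R n M)
  (a : forall p : M, tangent R n p -> tangent R n p -> R)
  (beta : forall p : M, tangent R n p -> R).
Hypothesis a_riemannian : riemannian_metric S a.
Hypothesis beta_form : one_form S beta.

Lemma riemannian_metric_rank_one (P K : R) :
  (forall p (v : E), v != 0 -> 0 < P * a (p := p) v v + K * beta (p := p) v ^+ 2) ->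
  riemannian_metric S (fun p u v => P * a (p := p) u v + K * (beta u * beta v)).
Proof.
case: a_riemannian beta_form => aC aS _ asm [bS bsm] pos; split.
- by move=> p u v; rewrite aC [beta u * _]mulrC.
- by move=> p u k v w; rewrite aS bS; ring.
- by move=> p v v0; rewrite -expr2; exact: pos.
- move=> c Sc i j k; have oU : open (chart_img c) by exact: chart_img_open.
  apply: Ck_add => //; apply: Ck_mul => //; try exact: Ck_cst.
    exact: asm.
  by apply: Ck_mul => //; exact: bsm.
Qed.

Lemma one_form_scale (k : R) : one_form S (fun p v => k * beta (p := p) v).
Proof.
case: beta_form => bS bsm; split=> [p r u v|c Sc i m]; first by rewrite bS; ring.
have oU : open (chart_img c) by exact: chart_img_open.
by apply: Ck_mul => //; [exact: Ck_cst|exact: bsm].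
Qed.

End Metrics.

(** Multiplying by |u| clears the denominators of s; at u = 0 both sides are 0. *)
Lemma ab_norm_quadratic {R : realType} n (X : 'rV[R]_n) (phi : R -> R) (eps P K : R) u :
  phi (slope X u) = eps * slope X u + Num.sqrt (P + K * slope X u ^+ 2) ->
  ab_norm X phi u = Num.sqrt (P * dot u u + K * dot X u ^+ 2) + eps * dot X u.
Proof.
move=> phiE; have [->|u0] := eqVneq u 0.
  by rewrite /ab_norm /enorm !dot0r expr0n/= !(mulr0, addr0, sqrtr0, mul0r).
have n0 : 0 < enorm u by exact: enorm_gt0.
have XE : dot X u = slope X u * enorm u by rewrite /slope divfK// gt_eqF.
rewrite /ab_norm phiE -sqr_enorm XE.
rewrite (_ : P * _ + _ = enorm u ^+ 2 * (P + K * slope X u ^+ 2)); last by ring.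
by rewrite sqrtrM ?sqr_ge0// sqrtr_sqr (gtr0_norm n0); ring.
Qed.

Section QuadraticPhi.
Context {R : realType} {n : nat} {G : groupTopologicalType}.
Local Notation E := 'rV[R]_n.+1.
Variable L : lie_structure R n G.
Variable atilde : forall p : G, tangent R n p -> tangent R n p -> R.
Hypothesis atilde_riemannian : riemannian_metric L atilde.
Hypothesis atilde_left_invariant : left_invariant_metric L atilde.
Variable e : 'I_n.+1 -> vector_field R n G.
Hypothesis e_orthonormal : orthonormal_frame L atilde e.
Variable X : vector_field R n G.
Hypothesis X_left_invariant : left_invariant_field L X.
Local Notation xi := (field_coef atilde e X).
Local Notation beta := (fun p (y : tangent R n p) => atilde y (X p)).
Hypothesis beta_form : one_form L beta.
Variables (F : forall p : G, tangent R n p -> R) (phi : R -> R).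
Hypothesis FE : forall p (v : tangent R n p),
  F v = ab_norm xi phi (\row_i atilde v (e i p)).
Variables (eps P K : R).
Hypothesis quad_gt0 : forall s : R, `|s| <= enorm xi -> 0 < P + K * s ^+ 2.
Hypothesis phiE : forall s : R, `|s| <= enorm xi ->
  phi s = eps * s + Num.sqrt (P + K * s ^+ 2).

Definition quad_metric (p : G) (u v : tangent R n p) : R :=
  P * atilde u v + K * (atilde u (X p) * atilde v (X p)).

Lemma quad_metricE p (v : tangent R n p) : let u := \row_i atilde v (e i p) in
  quad_metric v v = P * dot u u + K * dot xi u ^+ 2.
Proof.
move=> u; rewrite /quad_metric -expr2 (metric_frame atilde_riemannian e_orthonormal).
by rewrite (form_frame atilde_riemannian atilde_left_invariant e_orthonormal X_left_invariant).
Qed.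

Lemma frame_neq0 p (v : tangent R n p) : (v : E) != 0 ->
  \row_i atilde v (e i p) != 0.
Proof.
move=> v0; rewrite -dot_gt0 -(metric_frame atilde_riemannian e_orthonormal).
by case: atilde_riemannian => _ _ + _; apply.
Qed.

(** The new form is |u|^2 times the positive function P + K s^2. *)
Lemma quad_gt0_dot (u : E) : u != 0 -> 0 < P * dot u u + K * dot xi u ^+ 2.
Proof.
move=> u0; have n0 : 0 < enorm u by exact: enorm_gt0.
have XE : dot xi u = slope xi u * enorm u by rewrite /slope divfK// gt_eqF.
rewrite -sqr_enorm XE.
rewrite (_ : _ + _ = enorm u ^+ 2 * (P + K * slope xi u ^+ 2)); last by ring.
by rewrite mulr_gt0 ?exprn_gt0// quad_gt0// norm_slope_le.
Qed.

Lemma quad_metric_riemannian : riemannian_metric L quad_metric.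
Proof.
apply: (riemannian_metric_rank_one atilde_riemannian beta_form) => p v v0.
have := quad_metricE (p := p) v; rewrite /quad_metric -expr2 /= => ->.
exact/quad_gt0_dot/frame_neq0.
Qed.

Lemma quad_metric_norm p (v : tangent R n p) :
  F v = metric_norm quad_metric v + eps * atilde v (X p).
Proof.
rewrite FE /metric_norm quad_metricE.
rewrite (form_frame atilde_riemannian atilde_left_invariant e_orthonormal X_left_invariant).
by apply: ab_norm_quadratic; rewrite phiE// norm_slope_le.
Qed.

End QuadraticPhi.

(** * The theorem *)

Theorem theorem3p2 (R : realType) (G : groupTopologicalType)
  (L : lie_structure R 4 G)
  (G_simply_connected : simply_connected R G)
  (G_nilpotent : nilpotent_group G)
  (atilde : forall p : G, tangent R 4 p -> tangent R 4 p -> R)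
  (atilde_riemannian : riemannian_metric L atilde)
  (atilde_left_invariant : left_invariant_metric L atilde)
  (e : 'I_5 -> vector_field R 4 G)
  (e_orthonormal : orthonormal_frame L atilde e)
  (a b c d f g : R)
  (a_gt0 : 0 < a) (d_gt0 : 0 < d) (g_gt0 : 0 < g)
  (b_f : 0 < b \/ b = 0 /\ 0 <= f)
  (e_brackets : l57_brackets L a b c d f g e)
  (X : vector_field R 4 G)
  (X_left_invariant : left_invariant_field L X)
  (F : forall p : G, tangent R 4 p -> R)
  (F_alpha_beta : alpha_beta_metric L atilde (fun p y => atilde p y (X p)) F)
  (F_left_invariant : left_invariant_finsler L F)
  (F_non_riemannian : ~ is_riemannian L F)
  (F_douglas : douglas_type L F) :
  randers_metric L F.
Proof.
have [phi [phi1 [phi2 [phiP FE]]]] := alpha_beta_frame atilde_riemannian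
  atilde_left_invariant e_orthonormal X_left_invariant F_alpha_beta.
have [Q [Qr Ql QE]] := douglas_frame atilde_riemannian
  e_orthonormal F_alpha_beta F_douglas phiP FE.
have [_ beta_form F_finsler _] := F_alpha_beta.
set xi := field_coef atilde e X in phiP FE QE.
have dphi (s : R) (sx : `|s| <= enorm xi) : is_derive s 1 phi (phi1 s) by case: (phiP s sx).
have dphi1 (s : R) (sx : `|s| <= enorm xi) : is_derive s 1 phi1 (phi2 s) by case: (phiP s sx).
have phi_gt0 (s : R) (sx : `|s| <= enorm xi) : 0 < phi s by case: (phiP s sx).
have kap_gt0 (s : R) (sx : `|s| <= enorm xi) : 0 < kappa phi phi1 s by case: (phiP s sx).
have Delta_gt0 (s : R) (sx : `|s| <= enorm xi) :
    0 < kappa phi phi1 s + (enorm xi ^+ 2 - s ^+ 2) * phi2 s by case: (phiP s sx).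
have x00 : `|0 : R| <= enorm xi by rewrite normr0 enorm_ge0.
have no_riemannian K : ~ (forall s : R, `|s| <= enorm xi -> 0 < 1 + K * s ^+ 2 /\
    phi s ^+ 2 = phi 0 ^+ 2 * (1 + K * s ^+ 2)).
  move=> phiK; apply: F_non_riemannian.
  pose P := phi 0 ^+ 2.
  have P_gt0 : 0 < P by rewrite exprn_gt0 ?phi_gt0.
  have quad s : `|s| <= enorm xi -> 0 < P + P * K * s ^+ 2.
    by move=> /phiK[+ _]; rewrite -(pmulr_rgt0 _ P_gt0) mulrDr mulr1 mulrA.
  have phiE s : `|s| <= enorm xi -> phi s = 0 * s + Num.sqrt (P + P * K * s ^+ 2).
    move=> sx; have [_ phi2E] := phiK s sx; rewrite mul0r add0r.
    rewrite -[P * K * _]mulrA -{1}[P]mulr1 -mulrDr -phi2E sqrtr_sqr.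
    by rewrite gtr0_norm// phi_gt0.
  exists (quad_metric atilde X P (P * K)).
    exact: (quad_metric_riemannian atilde_riemannian atilde_left_invariant
      e_orthonormal X_left_invariant beta_form quad).
  move=> p v; rewrite (quad_metric_norm atilde_riemannian atilde_left_invariant
    e_orthonormal X_left_invariant FE phiE) mul0r addr0.
  by [].
(* For x = 0 the slope is always 0 and F = phi(0) alpha. *)
have xi0 : xi != 0.
  apply/eqP => xi0; apply: (no_riemannian 0) => s.
  rewrite xi0 /enorm dot0l sqrtr0 normr_le0 => /eqP->.
  by rewrite mul0r addr0 mulr1 ltr01.
have b_gt0 : 0 < enorm xi by exact: enorm_gt0.
have br_form := l57_bracket_form atilde_riemannian e_orthonormal e_brackets.
have [[K ode]|[k ode]] := l57_douglas (lt0r_neq0 a_gt0) (lt0r_neq0 d_gt0)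
    (lt0r_neq0 g_gt0) br_form Ql Qr (bracket_linearl L atilde e)
    (bracket_linearr L atilde e) (bracket_skew L atilde e) QE xi0 kap_gt0 Delta_gt0.
  case: (no_riemannian K).
  exact: (riemannian_ode b_gt0 dphi dphi1 phi_gt0 kap_gt0 ode).
have [eps [C [C_gt0 mu_gt0 phiE epsC]]] := randers_ode b_gt0 dphi dphi1 phi_gt0
  kap_gt0 Delta_gt0 ode.
set m := 1 - k * enorm xi ^+ 2 in mu_gt0 phiE.
have m_gt0 : 0 < m by have := mu_gt0 0 x00; rewrite expr0n mulr0 addr0.
have quad s : `|s| <= enorm xi -> 0 < C ^+ 2 * m + C ^+ 2 * k * s ^+ 2.
  by move=> /mu_gt0 mu; rewrite -mulrA -mulrDr mulr_gt0 ?exprn_gt0.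
have phiE' s : `|s| <= enorm xi ->
    phi s = eps * s + Num.sqrt (C ^+ 2 * m + C ^+ 2 * k * s ^+ 2).
  move=> sx; rewrite phiE// -[C ^+ 2 * k * _]mulrA -mulrDr sqrtrM ?sqr_ge0//.
  by rewrite sqrtr_sqr gtr0_norm.
split=> //.
exists (quad_metric atilde X (C ^+ 2 * m) (C ^+ 2 * k)), (fun p v => eps * atilde p v (X p)).
split.
- exact: (quad_metric_riemannian atilde_riemannian atilde_left_invariant
      e_orthonormal X_left_invariant beta_form quad).
- exact: (one_form_scale beta_form).
- move=> p; apply: (@le_lt_trans _ _ (`|eps| * enorm xi / C)); last first.
    by rewrite ltr_pdivrMr// mul1r.
  apply: ge_sup.
    exists `|eps * atilde p (0 : 'rV[R]_5) (X p)|, (0 : 'rV[R]_5) => //=.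
    have [aC aS _ _] := atilde_riemannian.
    have a0 w : atilde p (0 : 'rV[R]_5) w = 0.
      by rewrite aC -(scale0r (0 : 'rV[R]_5)) scalar_scale ?mul0r.
    by rewrite /metric_norm /quad_metric !a0 !(mulr0, mul0r) addr0 sqrtr0.
  move=> _ [v /= v1 <-].
  have betaE := form_frame atilde_riemannian atilde_left_invariant e_orthonormal
    X_left_invariant v.
  rewrite betaE; move: v1; rewrite /metric_norm (quad_metricE atilde_riemannian
    atilde_left_invariant e_orthonormal X_left_invariant) -/xi.
  set u := \row_i _; set A := _ + _ => A1.
  have CS : dot xi u ^+ 2 <= enorm xi ^+ 2 * dot u u.
    by rewrite sqr_enorm dot_cauchy_schwarz.
  have AE : enorm xi ^+ 2 * A - C ^+ 2 * dot xi u ^+ 2 =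
      C ^+ 2 * m * (enorm xi ^+ 2 * dot u u - dot xi u ^+ 2).
    by rewrite /A /m; ring.
  have A_ge : C ^+ 2 * dot xi u ^+ 2 <= enorm xi ^+ 2 * A.
    by rewrite -subr_ge0 AE mulr_ge0 ?subr_ge0// mulr_ge0 ?sqr_ge0// ltW.
  have A_ge0 : 0 <= A.
    rewrite -(pmulr_rge0 _ (exprn_gt0 2 b_gt0)); apply: le_trans A_ge.
    by rewrite mulr_ge0 ?sqr_ge0.
  rewrite normrM ler_pdivlMr// -mulrA ler_wpM2l// mulrC.
  apply: (@le_trans _ _ (enorm xi * Num.sqrt A)); last first.
    by rewrite ler_piMr// enorm_ge0.
  rewrite -(@ler_pXn2r _ 2) ?nnegrE ?mulr_ge0 ?sqrtr_ge0 ?enorm_ge0 ?(ltW C_gt0)//.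
  by rewrite !exprMn (sqr_sqrtr A_ge0) real_normK ?num_real.
- exact: (quad_metric_norm atilde_riemannian atilde_left_invariant
    e_orthonormal X_left_invariant FE phiE').
Qed.
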